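(* Let $a>0$, $q=q(r)\in Q_a$, and let $\mathcal L$ be a subset of the nonnegative integers such that $$\sum_{\ell\in\mathcal L,\ \ell\ne0}\frac1\ell=\infty .$$ Then the set of fixed-energy ($k=1$) phase shifts $\{\delta_\ell\}_{\ell\in\mathcal L}$ determines $q(r)$ uniquely. That is, if $q_1(r),q_2(r)\in Q_a$ are spherically symmetric and their phase shifts satisfy $\delta^{(1)}_\ell=\delta^{(2)}_\ell$ for all $\ell\in\mathcal L$, then $q_1=q_2$ almost everywhere.
   Context: $Q_a$ is the set of real-valued potentials $q$ on $\mathbb{R}^3$ with $q(x)=0$ for $|x|>a$ and $q\in L^p(B_a)$ for some $p>\frac32$, $B_a=\{x\in\mathbb{R}^3:|x|\le a\}$; here $q=q(r)$, $r=|x|$, is spherically symmetric. For $\ell=0,1,2,\dots$ let $\varphi_\ell(r)$ be the regular solution of $$\varphi_\ell''+\varphi_\ell-\frac{\ell(\ell+1)}{r^2}\varphi_\ell-q(r)\varphi_\ell=0,\quad r>0,\qquad \varphi_\ell=\frac{r^{\ell+1}}{(2\ell+1)!!}+o(r^{\ell+1}),\quad r\to0.$$ The phase shift $\delta_\ell$ (at $k=1$, defined modulo $\pi$) is determined by $\varphi_\ell(r)=|F_\ell|\sin\left(r-\frac{\ell\pi}2+\delta_\ell\right)+o(1)$ as $r\to+\infty$, where $|F_\ell|\ne0$ is a constant. *)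

(* Defs.v *)
From HB Require Import structures.
From mathcomp Require Import all_boot all_order all_algebra.
From mathcomp Require Import all_classical all_reals all_analysis.

Set Implicit Arguments.
Unset Strict Implicit.
Unset Printing Implicit Defensive.

Import Order.TTheory GRing.Theory Num.Theory.
Import numFieldNormedType.Exports.

Local Open Scope classical_set_scope.
Local Open Scope ring_scope.

(* The library's norm on R * R * R is the sup norm, hence [enorm3]. *)
Definition enorm3 (R : realType) (x : R * R * R) : R :=
  Num.sqrt (x.1.1 ^+ 2 + x.1.2 ^+ 2 + x.2 ^+ 2).

Definition cball3 (R : realType) (a : R) : set (R * R * R) :=
  [set x | enorm3 x <= a].

Definition lebesgue_measure3 (R : realType) :=
  ((@lebesgue_measure R \x @lebesgue_measure R) \x @lebesgue_measure R)%E.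

(* Elements of L^p are represented by Borel functions. *)
Definition potential_class (R : realType) (a : R) : set (R * R * R -> R) :=
  [set q | (forall x, a < enorm3 x -> q x = 0) /\
    exists2 p : R, 3%:R / 2%:R < p &
      (q \_ (cball3 a)) \in Lfun (@lebesgue_measure3 R) p%:E].

Definition spherical (R : realType) (q : R -> R) : R * R * R -> R :=
  fun x => q (enorm3 x).

(* [u] is locally absolutely continuous on ]0, +oo[ with derivative [v] a.e.,
   i.e. an indefinite integral of the locally integrable [v]. *)
Definition ac_derivative (R : realType) (u v : R -> R) : Prop :=
  forall s t : R, 0 < s -> s <= t ->
    (@lebesgue_measure R).-integrable `[s, t] (EFin \o v) /\
    u t - u s = Rintegral (@lebesgue_measure R) `[s, t] v.

(* As [q] is only L^p, the equation is understood in the sense of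
   Caratheodory: phi' exists everywhere, is locally absolutely continuous,
   and its derivative [phi2] satisfies the equation almost everywhere. *)
Definition radial_solution (R : realType) (q : R -> R) (l : nat)
    (phi : R -> R) : Prop :=
  (forall r : R, 0 < r -> derivable phi r 1) /\
  exists2 phi2 : R -> R, ac_derivative (derive1 phi) phi2 &
    {ae @lebesgue_measure R, forall r : R, 0 < r ->
      phi2 r + phi r - (l * l.+1)%:R / r ^+ 2 * phi r - q r * phi r = 0}.

Definition odd_dfact (l : nat) : nat := (\prod_(i < l.+1) (2 * i + 1))%N.

Definition regular_solution (R : realType) (q : R -> R) (l : nat)
    (phi : R -> R) : Prop :=
  radial_solution q l phi /\
  phi = (fun r : R => r ^+ l.+1 / (odd_dfact l)%:R)
    +o_ ((0 : R)^'+) (fun r : R => r ^+ l.+1).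

(* The condition determines [delta] up to a multiple of 2 pi; phase shifts
   are compared modulo pi, through [eq_mod_pi]. *)
Definition is_phase_shift (R : realType) (q : R -> R) (l : nat)
    (delta : R) : Prop :=
  exists2 phi : R -> R, regular_solution q l phi &
    exists2 F : R, 0 < F &
      (phi r - F * sin (r - l%:R * pi / 2%:R + delta)) @[r --> +oo%R]
        --> (0 : R).

Definition eq_mod_pi (R : realType) (x y : R) : Prop :=
  exists n : int, x = y + n%:~R * pi.

(* Main.v *)
From HB Require Import structures.
Require Import Defs.
From mathcomp Require Import all_boot all_order all_algebra.
From mathcomp Require Import all_classical all_reals all_analysis.
From mathcomp Require Import measurable_realfun ring lra zify.

Set Implicit Arguments.
Unset Strict Implicit.
Unset Printing Implicit Defensive.

Import Order.TTheory GRing.Theory Num.Theory.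
Import numFieldNormedType.Exports.
Local Open Scope classical_set_scope.
Local Open Scope ring_scope.

(* Write [phi_l = r^(l+1) m_k / (2l+1)!!] with [k = 2l+1], so that [m_k] tends to
   1 at 0. If the phase shifts agree then the Wronskian of the two regular
   solutions is constant beyond [a] and arbitrarily small far away, hence zero;
   as the integral of its derivative, it yields
     int t^(k+1) (q2 - q1) m_k^(1) m_k^(2) dt = 0   for k = 2l+1, l in L.
   The map [x^k |-> x^k m_k(x)] is a small perturbation of the identity on
   polynomials [p] vanishing to high order at 0: the function
     P(r, y) = sum_k p_k m_k(r) y^k
   satisfies [P(0, y) = p(y)], and the equation of [m_k] expresses its derivative
   in [r] through the integral over [t < r] of [t (q - 1) P(t, t y / r)], so that
   [P(r, y) - p(y)] is controlled by the values of [p] alone, whatever its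
   coefficients. By Muntz's theorem the error can again be approximated by
   polynomials with exponents in the same set, and iterating shows that
   [t^(n+1) (q2 - q1)] annihilates all continuous functions vanishing at 0. *)

(** * Muntz's theorem *)

Section Muntz.
Variable R : realType.
Implicit Types (p q : {poly R}) (h : R -> R).

(** The polynomials given by Muntz's theorem have coefficients of uncontrolled size, so bounds on
    each [m_k - 1] cannot be summed against them; hence an estimate on the polynomial as a whole, by
    its supremum only. Smallness comes from the order of vanishing: [|P(t, z)| <= B z^(M+1)] bounds
    the derivative in [r] by [B y^(M+1) r^-(M+2)] times the integral of [t^2 |q - 1| t^M], and for
    large [M] that integral is at most [eta r^(be + M + 1)], uniformly in [r], with [be = 2 - 3/p].
    The hypothesis [p > 3/2] says that [be > 0], and makes [r^(be - 1)] integrable at 0. High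
    vanishing costs nothing: without finitely many exponents the sum of reciprocals still diverges,
    and the common factor [t^n] moves into the weight, whence [t^(n+1) (q2 - q1)]. The product of
    the two [m_k] is treated as two perturbations in succession. The other obstacle is at infinity:
    a phase shift prescribes the asymptotics of a solution but not of its derivative, so the
    Wronskian is shown to be small only at well-chosen points, which suffices for a constant. *)

Definition supported p (S : nat -> Prop) := forall k, p`_k != 0 -> S k.

(** At a maximum point [c < 1] the term [c p'(c)] vanishes, whether [c] is interior or 0, and the
    equation reduces to [mu p(c) = q(c)]; the end point 1 has its own hypothesis. *)
Lemma poly_max_principle p q (mu K : R) :
  0 < mu -> p.[1] <= K ->
  (forall x : R, 0 <= x <= 1 -> q.[x] <= mu * K) ->
  'X * p^`() = mu *: p - q ->
  forall x : R, 0 <= x <= 1 -> p.[x] <= K.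
Proof.
move=> mu0 p1 qK E.
have [|c c01 cmax] := @EVT_max R (horner p) 0 1 (@ler01 R).
  by apply: continuous_subspaceT; apply: continuous_horner.
move=> x x01; apply: (@le_trans _ _ p.[c]); first by apply: cmax; rewrite in_itv.
move: (c01); rewrite in_itv /= => /andP[c0 c1].
move: c1; rewrite le_eqVlt => /predU1P[->//|c1].
have E' : mu * p.[c] = q.[c] + c * p^`().[c].
  have := congr1 (horner^~ c) E; rewrite /= !hornerE => ->; lra.
have : c * p^`().[c] = 0.
  move: c0; rewrite le_eqVlt => /predU1P[<-|c0]; first by rewrite mul0r.
  have d0 : is_derive c 1 (horner p) 0.
    apply: (@derive1_at_max _ _ 0 1) => //.
    - by rewrite in_itv /= c0 c1.
    - move=> t; rewrite in_itv /= => /andP[/ltW t0 /ltW t1].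
      by apply: cmax; rewrite in_itv /= t0 t1.
  have [_ d1] := is_derive_poly p c; case: d0 => _ d0.
  by rewrite -d1 d0 mulr0.
move=> z; move: E'; rewrite z addr0 => E'.
by rewrite -(ler_pM2l mu0) E'; apply: qK; rewrite c0 ltW.
Qed.

(* One step of von Golitschek's proof of Muntz's theorem: the solution [p'] of
   [x p' ' - mu p' = - (mu - m) p], [p' 1 = 0]. *)
Lemma golitschek_step p (S : nat -> Prop) (m mu : nat) (A : R) :
  (0 < m)%N -> (m < mu)%N -> ~ S mu -> (forall k, S k -> (m < k)%N) ->
  p`_m = 1 -> supported p (fun k => k = m \/ S k) ->
  (forall x : R, 0 <= x <= 1 -> `|p.[x]| <= A) ->
  exists p', [/\ p'`_m = 1, supported p' (fun k => k = m \/ k = mu \/ S k) &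
    forall x : R, 0 <= x <= 1 -> `|p'.[x]| <= (1 - m%:R / mu%:R) * A].
Proof.
move=> m0 mmu Smu Sm pm psupp pA.
(* The operator [x d/dx - mu] is diagonal on monomials, so the equation is solved coefficient by
   coefficient. The factor is 1 at [k = m], and at [k = mu] the coefficient of [p] is 0. *)
pose c k : R := (mu%:R - m%:R) / (mu%:R - k%:R).
pose q := \poly_(k < size p) (c k * p`_k).
have qk k : q`_k = c k * p`_k.
  rewrite coef_poly; case: ltnP => // sk; first by rewrite nth_default ?mulr0.
have pmu : p`_mu = 0.
  apply/eqP/negPn/negP => /psupp[]; last by [].
  by move=> E; rewrite E ltnn in mmu.
(* ['X^mu] is in the kernel of the operator; this multiple of it gives the value 0 at 1 that the
   maximum principle needs. *)
pose p' := q - q.[1] *: 'X^mu.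
have p'k k : p'`_k = c k * p`_k - q.[1] * (k == mu)%:R.
  by rewrite coefB qk coefZ coefXn.
have mumneq0 : mu%:R - m%:R != 0 :> R by rewrite subr_eq0 eqr_nat gtn_eqF.
have mu0 : (0 : R) < mu%:R by rewrite ltr0n; apply: leq_trans mmu.
have E : 'X * p'^`() = mu%:R *: p' - (mu%:R - m%:R) *: p.
  apply/polyP => k; rewrite coefXM coefB !coefZ coef_deriv p'k.
  have [->|kmu] := eqVneq k mu.
    case: eqP => [mu00|_]; first by rewrite mu00 in mmu.
    rewrite prednK ?(leq_trans _ mmu)// p'k pmu eqxx !mulr0 mulr1 sub0r subr0.
    by rewrite mulr_natl.
  case: k kmu => [|k] kmu /=.
    rewrite p'k (negbTE kmu) mulr0 subr0 /c subr0; field; by rewrite gt_eqF.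
  rewrite p'k (negbTE kmu) !mulr0 !subr0 -[in LHS]mulr_natl /c.
  have : mu%:R - k.+1%:R != 0 :> R by rewrite subr_eq0 eqr_nat eq_sym.
  by move: (k.+1%:R : R) (mu%:R : R) (m%:R : R) => *; field.
have p'1 : p'.[1] = 0 by rewrite /p' !hornerE expr1n mulr1 subrr.
exists p'; split.
- rewrite p'k pm ltn_eqF// mulr0 subr0 mulr1 /c divff//.
- move=> k; rewrite p'k; have [->|kmu] := eqVneq k mu; first by right; left.
  rewrite mulr0 subr0 mulf_eq0 negb_or => /andP[_ /psupp[]]; by [left|right; right].
- have A0 : 0 <= A by apply: le_trans (pA 0 _); rewrite // lexx ler01.
  have mmu' : (m%:R : R) < mu%:R by rewrite ltr_nat.
  have -> : (1 - m%:R / mu%:R) * A = (mu%:R - m%:R) * A / mu%:R.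
    by field; rewrite gt_eqF.
  have K0 : 0 <= (mu%:R - m%:R) * A / mu%:R :> R.
    by apply: divr_ge0; [apply: mulr_ge0; rewrite // subr_ge0 ltW|exact: ltW].
  have mK : mu%:R * ((mu%:R - m%:R) * A / mu%:R) = (mu%:R - m%:R) * A.
    by field; rewrite gt_eqF.
  move=> x x01; rewrite ler_norml; apply/andP; split.
    rewrite lerNl -hornerN.
    apply: (@poly_max_principle _ (- ((mu%:R - m%:R) *: p)) mu%:R) x01 => //.
    + by rewrite hornerN p'1 oppr0.
    + move=> y y01; rewrite mK hornerN hornerZ -mulrN ler_pM2l ?subr_gt0//.
      by have := pA _ y01; rewrite ler_norml => /andP[]; rewrite lerNl.
    + by rewrite derivN mulrN E scalerN opprB opprK addrC.
  apply: (@poly_max_principle _ ((mu%:R - m%:R) *: p) mu%:R) x01 => //.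
  + by rewrite p'1.
  + move=> y y01; rewrite mK hornerZ ler_pM2l ?subr_gt0//.
    by have := pA _ y01; rewrite ler_norml => /andP[].
Qed.

(** As [p - 'X^m] has its exponents in [s], the product bounds the distance from [x^m] to the span
    of the monomials of [s]; each exponent takes one step and contributes one factor. *)
Lemma golitschek (m : nat) (s : seq nat) :
  (0 < m)%N -> uniq s -> (forall k, k \in s -> (m < k)%N) ->
  exists p, [/\ p`_m = 1, supported p (fun k => k = m \/ k \in s) &
    forall x : R, 0 <= x <= 1 -> `|p.[x]| <= \prod_(k <- s) (1 - m%:R / k%:R)].
Proof.
move=> m0; elim: s => [_ _|mu s IH /= /andP[mus us] sm].
  exists 'X^m; split; first by rewrite coefXn eqxx.
  - by move=> k; rewrite coefXn; have [->|_] := eqVneq k m; [left|rewrite eqxx].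
  - move=> x /andP[x0 x1]; rewrite big_nil hornerXn normrX (ger0_norm x0).
    by apply: exprn_ile1.
have [//||p [p1 p2 p3]] := IH.
  by move=> k ks; apply: sm; rewrite inE ks orbT.
have [|||p' [q1 q2 q3]] := @golitschek_step p (fun k => k \in s) m mu _ m0 _ _ _ p1 p2 p3.
- by apply: sm; rewrite mem_head.
- exact/negP.
- by move=> k ks; apply: sm; rewrite inE ks orbT.
exists p'; split => //; last by move=> x x01; rewrite big_cons; apply: q3.
move=> k /q2[|[->|ks]]; [by left|by right; rewrite mem_head|right].
by rewrite inE ks orbT.
Qed.

(** Divergence of the sum of [1/k] over [S], put in a finite form from which any initial segment can
    be discarded. *)
Definition muntz_set (S : nat -> Prop) := forall (N : nat) (K : R),
  exists s : seq nat, [/\ uniq s, forall k, k \in s -> S k /\ (N < k)%N &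
    K <= \sum_(k <- s) (k%:R)^-1].

Lemma prod_expR_le (m : nat) (s : seq nat) :
  (forall k, k \in s -> (m < k)%N) ->
  \prod_(k <- s) (1 - m%:R / k%:R) <= expR (- (m%:R * \sum_(k <- s) (k%:R)^-1)) :> R.
Proof.
elim: s => [_|k s IH H]; first by rewrite !big_nil mulr0 oppr0 expR0.
rewrite !big_cons mulrDr opprD expRD; apply: ler_pM.
- rewrite subr_ge0 ler_pdivrMr ?mul1r ?ler_nat ?ltr0n.
    by apply: ltnW; apply: H; rewrite mem_head.
  by apply: leq_trans (H k _); rewrite // mem_head.
- rewrite big_seq; apply: prodr_ge0 => i si.
  have mi : (m < i)%N by apply: H; rewrite inE si orbT.
  rewrite subr_ge0 ler_pdivrMr ?mul1r ?ler_nat ?ltr0n; first exact: ltnW.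
  exact: leq_trans mi.
- exact: expR_ge1Dx.
- by apply: IH => i si; apply: H; rewrite inE si orbT.
Qed.

Lemma muntz_monomial (S : nat -> Prop) (m : nat) (e : R) :
  muntz_set S -> (0 < m)%N -> 0 < e ->
  exists p, supported p S /\ forall x : R, 0 <= x <= 1 -> `|x ^+ m - p.[x]| <= e.
Proof.
move=> MS m0 e0.
(* With reciprocals summing to at least [1/e], the product is at most [expR (- m / e)], hence at
   most [e] because [1 + x <= expR x]. *)
have [s [us sS sK]] := MS m e^-1.
have sm k : k \in s -> (m < k)%N by move=> /sS[].
have [p [p1 p2 p3]] := golitschek m0 us sm.
exists ('X^m - p); split.
  move=> k; rewrite coefB coefXn; have [->|km] := eqVneq k m.
    by rewrite p1 subrr eqxx.
  rewrite sub0r oppr_eq0 => /p2[E|/sS[]//].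
  by rewrite E eqxx in km.
move=> x x01; rewrite !hornerE opprB addrC subrK.
apply: (le_trans (p3 _ x01)); apply: (le_trans (prod_expR_le sm)).
rewrite expRN -[leRHS]invrK lef_pV2 ?posrE ?expR_gt0 ?invr_gt0//.
apply: le_trans (expR_ge1Dx _).
apply: (le_trans sK); rewrite ler_wpDl// ler_peMl ?ler1n//.
by apply: sumr_ge0 => i _; rewrite invr_ge0.
Qed.

(* [bernstein n f] is the n-th Bernstein polynomial of [f (_ / n)]; the
   recursion conditions on the first Bernoulli trial. *)
Fixpoint bernstein (n : nat) (f : nat -> R) : {poly R} :=
  if n is n'.+1 then
    'X * bernstein n' (f \o S) + (1 - 'X) * bernstein n' f
  else (f 0%N)%:P.

Lemma bernstein_at0 n f : (bernstein n f).[0] = f 0%N.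
Proof.
elim: n f => [|n IH] f /=; first by rewrite hornerC.
by rewrite !hornerE !IH; ring.
Qed.

Lemma bernstein_le n f g (x : R) : 0 <= x <= 1 ->
  (forall k, (k <= n)%N -> f k <= g k) ->
  (bernstein n f).[x] <= (bernstein n g).[x].
Proof.
move=> /andP[x0 x1]; elim: n f g => [|n IH] f g fg /=.
  by rewrite !hornerC fg.
rewrite !hornerE lerD// ler_wpM2l ?subr_ge0//; apply: IH => k kn.
  by apply: fg.
by apply: fg; apply: leqW.
Qed.

Lemma bernstein_lin n (a b : R) f g (x : R) :
  (bernstein n (fun k => a * f k + b * g k)).[x] =
  a * (bernstein n f).[x] + b * (bernstein n g).[x].
Proof.
elim: n f g => [|n IH] f g /=; first by rewrite !hornerC.
by rewrite !hornerE /comp (IH (f \o S) (g \o S)) IH; ring.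
Qed.

Lemma bernstein_cst n (a : R) (x : R) : (bernstein n (fun=> a)).[x] = a.
Proof.
elim: n => [|n IH] /=; first by rewrite hornerC.
by rewrite !hornerE /comp IH; ring.
Qed.

(** The second moment of a binomial variable, about an arbitrary [c] because the recursion turns the
    centre [c] into [c - 1]. At [c = n x] it is the variance. *)
Lemma bernstein_var n (c x : R) :
  (bernstein n (fun k => (k%:R - c) ^+ 2)).[x] =
  (n%:R * x - c) ^+ 2 + n%:R * x * (1 - x).
Proof.
elim: n c => [|n IH] c /=; first by rewrite hornerC; ring.
rewrite !hornerE IH.
have -> : bernstein n ((fun k => (k%:R - c) ^+ 2) \o S) =
          bernstein n (fun k => (k%:R - (c - 1)) ^+ 2).
  by congr bernstein; apply/funext => k /=; rewrite -natr1; ring.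
by rewrite IH -natr1; ring.
Qed.

Lemma heine_cantor h (a b e : R) :
  {within `[a, b], continuous h} -> 0 < e ->
  exists d : R, 0 < d /\ forall x y, a <= x <= b -> a <= y <= b ->
    `|x - y| < d -> `|h x - h y| <= e.
Proof.
move=> ch e0.
pose P (d x : R) := a <= x <= b -> forall y, a <= y <= b ->
  `|x - y| < d -> `|h x - h y| <= e.
have : \forall d \near 0^'+, `[a, b] `<=` P d.
  have /compact_near_coveringP := @segment_compact R a b; apply.
  move=> x x01.
  have /subspace_continuousP := ch => /(_ x x01) /cvgrPdist_le /(_ (e / 2)).
  rewrite divr_gt0// => /(_ isT); rewrite near_withinE => /nbhs_ballP[r /= r0 hr].
  pose r2 := r / 2.
  have r20 : 0 < r2 by rewrite divr_gt0.
  exists (ball x r2, [set d | 0 < d < r2]); first split => /=.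
  - by apply/nbhs_ballP; exists r2.
  - by near=> d; apply/andP; split; near: d; [exact: nbhs_right_gt|exact: nbhs_right_lt].
  move=> [x' d] /= [xx' /andP[d0 dr]] x'01 y y01 x'y.
  have h1 : `|h x - h x'| <= e / 2.
    apply: hr; rewrite ?in_itv//=.
    by apply: (lt_trans xx'); rewrite /r2; lra.
  have h2 : `|h x - h y| <= e / 2.
    apply: hr; rewrite ?in_itv//=.
    rewrite /ball/=; have -> : x - y = (x - x') + (x' - y) by ring.
    apply: (le_lt_trans (ler_normD _ _)).
    by move: xx' x'y dr; rewrite /ball/= /r2; lra.
  have -> : h x' - h y = - (h x - h x') + (h x - h y) by ring.
  by apply: (le_trans (ler_normD _ _)); rewrite normrN; lra.
move=> hP.
have [d [d0 hd]] : exists d : R, 0 < d /\ `[a, b] `<=` P d.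
  near (0 : R)^'+ => d; exists d; split; near: d => //.
  exact: nbhs_right_gt.
exists d; split => // x y xab yab.
by apply: hd => //; rewrite /= in_itv.
Unshelve. all: by end_near. Qed.

(** Chebyshev's argument: the positive operator [bernstein n] is applied to a quadratic majorant of
    [|h x - h y|]. The exact value at 0 is recorded so that, for [h 0 = 0], only monomials of
    positive degree occur. *)
Lemma weierstrass h (e : R) :
  {within `[0, 1], continuous h} -> 0 < e ->
  exists p : {poly R}, p.[0] = h 0 /\
    forall x : R, 0 <= x <= 1 -> `|h x - p.[x]| <= e.
Proof.
move=> ch e0.
have [H [H0 hH]] : exists H : R, 0 < H /\ forall x : R, 0 <= x <= 1 -> `|h x| <= H.
  have cn : {within `[0, 1], continuous (fun x => `|h x|)}.
    move=> x; apply: continuous_comp; [exact: ch|exact: norm_continuous].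
  have [c _ Hc] := EVT_max (@ler01 R) cn.
  exists (`|h c| + 1); split; first by rewrite ltr_pwDr.
  move=> x x01; apply: (le_trans (Hc x _)); first by rewrite in_itv.
  by rewrite lerDl.
have [d [d0 hd]] : exists d : R, 0 < d /\ forall x y : R, 0 <= x <= 1 -> 0 <= y <= 1 ->
    `|x - y| < d -> `|h x - h y| <= e / 2.
  by apply: heine_cantor => //; rewrite divr_gt0.
pose K : R := 2 * H / d ^+ 2.
have K0 : 0 < K by rewrite /K divr_gt0 ?exprn_gt0 ?mulr_gt0.
(* Uniform continuity settles [|x - y| < d]; otherwise [(x - y)^2 / d^2 >= 1], and the crude bound
   [2 H] is absorbed by the quadratic term. *)
have hK x y : 0 <= x <= 1 -> 0 <= y <= 1 -> `|h x - h y| <= e / 2 + K * (x - y) ^+ 2.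
  move=> x01 y01; have [xyd|xyd] := ltP `|x - y| d.
    apply: (le_trans (hd _ _ x01 y01 xyd)); rewrite lerDl mulr_ge0 ?(ltW K0)//.
    exact: sqr_ge0.
  apply: (le_trans (ler_normB _ _)); apply: (@le_trans _ _ (2 * H)).
    by rewrite mulr2n mulrDl mul1r lerD// hH.
  rewrite -[leLHS]add0r; apply: lerD; first by rewrite divr_ge0 ?ltW.
  rewrite /K mulrAC ler_pdivlMr ?exprn_gt0// ler_pM2l ?mulr_gt0//.
  by rewrite -(real_normK (num_real (x - y))) lerXn2r ?nnegrE ?(ltW d0).
have [n nK] : exists n : nat, K / (e / 2) < n.+1%:R.
  exists (Num.truncn (K / (e / 2))).
  exact: truncnS_gt.
pose f k := h (k%:R / n.+1%:R).
exists (bernstein n.+1 f); split; first by rewrite bernstein_at0 /f mul0r.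
move=> x x01.
have n0 : (0 : R) < n.+1%:R by rewrite ltr0n.
have bnd : forall k, (k <= n.+1)%N ->
    `|h x - f k| <= e / 2 + K / n.+1%:R ^+ 2 * (k%:R - n.+1%:R * x) ^+ 2.
  move=> k kn; apply: (le_trans (hK _ _ x01 _)).
    by rewrite divr_ge0//= ler_pdivrMr// mul1r ler_nat.
  rewrite lerD2l le_eqVlt; apply/orP; left; apply/eqP; field.
  by rewrite addrC natr1 gt_eqF.
pose g k : R := (e / 2) * 1 + K / n.+1%:R ^+ 2 * (k%:R - n.+1%:R * x) ^+ 2.
have bg k : (k <= n.+1)%N -> `|h x - f k| <= g k by rewrite /g mulr1; exact: bnd.
have Eg : (bernstein n.+1 g).[x] <= e.
  rewrite /g (@bernstein_lin _ _ _ (fun=> 1)) bernstein_cst bernstein_var subrr.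
  rewrite expr0n add0r mulr1.
  have -> : K / n.+1%:R ^+ 2 * (n.+1%:R * x * (1 - x)) = K / n.+1%:R * (x * (1 - x)).
    by field; rewrite gt_eqF.
  have : K / n.+1%:R * (x * (1 - x)) <= e / 2.
    apply: (@le_trans _ _ (K / n.+1%:R * 1)).
      rewrite ler_pM2l ?divr_gt0//; move: x01 => /andP[? ?]; nra.
    rewrite mulr1 ler_pdivrMr// mulrC -ler_pdivrMr ?divr_gt0//; exact: ltW.
  by move: (_ * (x * (1 - x))) => z; lra.
have Ec : h x = (bernstein n.+1 (fun=> h x)).[x] by rewrite bernstein_cst.
have Ed : h x - (bernstein n.+1 f).[x] =
    (bernstein n.+1 (fun k => 1 * h x + (-1) * f k)).[x].
  by rewrite (@bernstein_lin _ _ _ (fun=> h x)) -Ec; ring.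
rewrite Ed ler_norml; apply/andP; split.
  apply: (@le_trans _ _ (-1 * (bernstein n.+1 g).[x] + 0 * (bernstein n.+1 g).[x])).
    by rewrite mul0r addr0 mulN1r lerN2.
  rewrite -bernstein_lin; apply: bernstein_le => // k kn.
  by have := bg k kn; rewrite ler_norml => /andP[]; move: (g k) (f k) (h x) => ? ? ? ? ?; lra.
apply: le_trans Eg; apply: bernstein_le => // k kn.
by have := bg k kn; rewrite ler_norml => /andP[]; move: (g k) (f k) (h x) => ? ? ? ? ?; lra.
Qed.

(** The monomials of a Weierstrass approximant are replaced one at a time, each with a tolerance
    divided by the size of its coefficient. *)
Lemma muntz_dense (S : nat -> Prop) h (e : R) :
  muntz_set S -> {within `[0, 1], continuous h} -> h 0 = 0 -> 0 < e ->
  exists p, supported p S /\ forall x : R, 0 <= x <= 1 -> `|h x - p.[x]| <= e.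
Proof.
move=> MS ch h0 e0.
have [|p [p0 hp]] := @weierstrass h (e / 2) ch; first by rewrite divr_gt0.
have p00 : p`_0 = 0 by rewrite -horner_coef0 p0.
suff [p' [p'S pp']] : exists p', supported p' S /\
    forall x : R, 0 <= x <= 1 -> `|p.[x] - p'.[x]| <= e / 2.
  exists p'; split => // x x01.
  have -> : h x - p'.[x] = (h x - p.[x]) + (p.[x] - p'.[x]) by ring.
  apply: (le_trans (ler_normD _ _)).
  by have := hp _ x01; have := pp' _ x01; lra.
clear hp p0.
have : 0 < e / 2 by rewrite divr_gt0.
move: (e / 2) => {e0}e e0.
suff : forall n (e : R), 0 < e -> exists p', supported p' S /\
    forall x : R, 0 <= x <= 1 -> `|(\sum_(i < n) p`_i *: 'X^i).[x] - p'.[x]| <= e.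
  by move=> /(_ (size p) _ e0); rewrite -poly_def coefK.
elim=> [|n IH] d d0.
  exists 0; split; first by move=> k; rewrite coef0 eqxx.
  by move=> x _; rewrite big_ord0 subrr normr0 ltW.
have [|q [qS hq]] := IH (d / 2); first by rewrite divr_gt0.
have [n0|n0] := posnP n.
  exists q; split => // x x01; rewrite big_ord_recr/= n0 p00 scale0r addr0.
  by rewrite n0 in hq; apply: (le_trans (hq _ x01)); lra.
pose d' : R := d / 2 / (`|p`_n| + 1).
have pn1 : 0 < `|p`_n| + 1 by rewrite ltr_wpDl.
have [|r [rS hr]] := @muntz_monomial S n d' MS n0; first by rewrite !divr_gt0.
exists (q + p`_n *: r); split.
  move=> k; rewrite coefD coefZ.
  have [->|/qS//] := eqVneq q`_k 0.
  by rewrite add0r mulf_eq0 negb_or => /andP[_ /rS].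
move=> x x01; rewrite big_ord_recr/= !hornerD !hornerZ hornerXn.
set s := (\sum_(i < n) _).[x].
have -> : s + p`_n * x ^+ n - (q.[x] + p`_n * r.[x]) =
   (s - q.[x]) + p`_n * (x ^+ n - r.[x]) by ring.
apply: (le_trans (ler_normD _ _)); rewrite normrM.
have h1 := hq _ x01; have h2 := hr _ x01.
have : `|p`_n| * `|x ^+ n - r.[x]| <= (`|p`_n| + 1) * d'.
  by apply: ler_pM => //; rewrite lerDl.
have -> : (`|p`_n| + 1) * d' = d / 2 by rewrite /d' mulrC divfK// gt_eqF.
by rewrite -/s in h1; lra.
Qed.

End Muntz.

(** * Integration of radial functions on R^3 *)

Section RadialMeasure.
Variable R : realType.
Notation mu := (@lebesgue_measure R).

(* [lebesgue_measure] of an arbitrary set is its outer measure. *)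
Lemma lebesgue_measure_lipschitz (T : Type) (S : set T) (u v : T -> R) (K : R) :
  0 < K ->
  (forall t t', S t -> S t' -> `|u t - u t'| <= K * `|v t - v t'|) ->
  (mu (u @` S) <= (2 * K)%:E * mu (v @` S))%E.
Proof.
move=> K0 uv; have K20 : 0 < 2 * K by rewrite mulr_gt0.
rewrite muleC -lee_pdivrMr//.
apply: le_ereal_inf_tmp => _ /= [F [mF vF] <-].
rewrite lee_pdivrMr// muleC -nneseriesZl; last first.
  by move=> i _; exact: wlength_ge0.
pose G n := u @` (S `&` [set t | F n (v t)]).
have uG : u @` S `<=` \bigcup_n G n.
  move=> _ [t St <-]; have [n _ Fn] := vF (v t) (imageP v St).
  by exists n => //; exists t.
apply: (le_trans (le_outer_measure mu _ _ uG)).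
apply: (le_trans (outer_measure_sigma_subadditive mu G)).
apply: lee_nneseries => // n _.
have /ocitvP[F0|[[a b] /= ab Fab]] : ocitv (F n) by exact: (mF n).
  rewrite F0 wlength0 mule0 /G F0 (_ : _ `&` _ = set0) ?image_set0 ?outer_measure0//.
  by apply/seteqP; split => // t [].
rewrite Fab wlength_itv/= lte_fin ab.
have [->|/set0P[_ [t0 [St0 Ft0] _]]] := eqVneq (G n) set0.
  by rewrite outer_measure0 -EFinB -EFinM lee_fin mulr_ge0 ?(ltW K20)// subr_ge0 ltW.
(* [G n] lies within [K (b - a)] of any one of its points, on an unknown side: this is the origin of
   the factor 2. *)
have sub : G n `<=` `[u t0 - K * (b - a), u t0 + K * (b - a)].
  move=> _ [t [St Ft] <-]; rewrite /= in_itv/=.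
  move: Ft Ft0; rewrite /= Fab /= !in_itv /= => /andP[? ?] /andP[? ?].
  have : `|u t - u t0| <= K * (b - a).
    apply: (le_trans (uv _ _ St St0)); rewrite ler_pM2l//.
    by rewrite ler_norml; lra.
  by rewrite ler_norml; lra.
have Kba : 0 < K * (b - a) by rewrite mulr_gt0// subr_gt0.
suff <- : @lebesgue_measure R `[u t0 - K * (b - a), u t0 + K * (b - a)] =
    ((2 * K)%:E * (b%:E + (- a)%:E))%E by exact: (le_outer_measure mu _ _ sub).
rewrite lebesgue_measure_itv/= lte_fin.
have -> : u t0 - K * (b - a) < u t0 + K * (b - a) by lra.
by rewrite -!EFinB -EFinM; congr EFin; ring.
Qed.

(** The Euclidean norm on R^3 as a function of one coordinate [x], with [s] the sum of the squares
    of the other two. *)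
Let radius (s x : R) : R := Num.sqrt (s + x ^+ 2).

Lemma radius_sqr (s x : R) : 0 <= s -> radius s x ^+ 2 = s + x ^+ 2.
Proof. by move=> s0; rewrite sqr_sqrtr// addr_ge0// sqr_ge0. Qed.

Lemma radius_ge (s x : R) : 0 <= s -> `|x| <= radius s x.
Proof.
by move=> s0; rewrite -sqrtr_sqr ler_sqrt ?addr_ge0 ?sqr_ge0// lerDr.
Qed.

Lemma radius_diff (s x y : R) : 0 <= s ->
  `|radius s x - radius s y| * (radius s x + radius s y) = `|x - y| * `|x + y|.
Proof.
move=> s0; rewrite -[radius s x + radius s y]ger0_norm ?addr_ge0 ?sqrtr_ge0//.
rewrite -!normrM -!subr_sqr !radius_sqr//; congr (`| _ |); ring.
Qed.

Lemma radius_lip (s x y : R) : 0 <= s -> `|radius s x - radius s y| <= 1 * `|x - y|.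
Proof.
move=> s0; rewrite mul1r.
have hxy : `|x + y| <= radius s x + radius s y.
  by apply: (le_trans (ler_normD _ _)); rewrite lerD// radius_ge.
have [h0|h0] := eqVneq (radius s x + radius s y) 0.
  have hx0 : 0 <= radius s x by exact: sqrtr_ge0.
  have hy0 : 0 <= radius s y by exact: sqrtr_ge0.
  have -> : radius s x = 0 by lra.
  have -> : radius s y = 0 by lra.
  by rewrite subrr normr0.
have hp : 0 < radius s x + radius s y by rewrite lt_neqAle eq_sym h0 addr_ge0 ?sqrtr_ge0.
by rewrite -(ler_pM2r hp) radius_diff// ler_wpM2l.
Qed.

Lemma measurable_radius (s : R) : measurable_fun setT (radius s).
Proof.
have -> : radius s = Num.sqrt \o (fun x => s + x ^+ 2) by [].
apply: measurableT_comp.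
  by apply: continuous_measurable_fun; exact: sqrt_continuous.
by apply: measurable_funD => //; apply: measurable_funX.
Qed.

Lemma radius_surj (s r : R) : 0 <= s -> Num.sqrt s < r -> exists x, radius s x = r.
Proof.
move=> s0 sr; have r0 : 0 <= r by apply/ltW/(le_lt_trans _ sr)/sqrtr_ge0.
have sr2 : s <= r ^+ 2 by rewrite -(sqr_sqrtr s0) lerXn2r ?nnegrE ?sqrtr_ge0// ltW.
exists (Num.sqrt (r ^+ 2 - s)).
by rewrite /radius sqr_sqrtr ?subr_ge0// addrC subrK sqrtr_sqr ger0_norm.
Qed.

(** [radius s] is 1-Lipschitz and reaches every point beyond [Num.sqrt s], so that part of [B] is
    covered by the Lipschitz image of the preimage of [B]. *)
Lemma lebesgue_preimage_radius (s : R) (B : set R) : 0 <= s -> measurable B ->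
  (mu (B `&` `]Num.sqrt s, +oo[) <= 2%:E * mu (radius s @^-1` B))%E.
Proof.
move=> s0 mB.
have := @lebesgue_measure_lipschitz R (radius s @^-1` B) (radius s) id 1 ltr01
  (fun x y _ _ => radius_lip x y s0).
rewrite image_id (_ : 2 * 1 = 2 :> R) ?mulr1//; apply: le_trans.
apply: (le_outer_measure mu) => r [Br] /=; rewrite in_itv/= andbT => sr.
by have [x xr] := radius_surj s0 sr; exists x => //=; rewrite /preimage /= xr.
Qed.

(** Instead of a change of variables, a comparison of measures: the restriction of [mu] to the
    half-line is at most twice its image under [radius s]. *)
Lemma ge0_integral_radius (s : R) (G : R -> \bar R) : 0 <= s ->
  measurable_fun setT G -> (forall r, 0 <= G r)%E ->
  (\int[mu]_(r in `]Num.sqrt s, +oo[) G r <= 2%:E * \int[mu]_x G (radius s x))%E.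
Proof.
move=> s0 mG G0.
pose radius_m : measurableTypeR R -> measurableTypeR R := radius s.
have mh : measurable_fun setT radius_m := measurable_radius s.
set D := (X in (integral _ X _ <= _)%E).
have mD : measurable D by exact: measurable_itv.
pose m0 : measure (measurableTypeR R) R := mu.
pose m1 : measure (measurableTypeR R) R := mrestr m0 mD.
have k0 : (0 : R) <= 2 by [].
pose m2_ : measure (measurableTypeR R) R := mscale (NngNum k0) (pushforward m0 radius_m).
pose m2 := m2_ mh.
have -> : (2%:E * \int[mu]_x G (radius s x) = \int[m2]_x G x)%E.
  by rewrite ge0_integral_mscale// ge0_integral_pushforward.
rewrite (@eq_measure_integral _ (measurableTypeR R) R D m1); last first.
  by move=> A mA AD; rewrite /= /mrestr setIidl.
apply: (@le_trans _ _ (\int[m2]_(x in D) G x)%E).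
  apply: ge0_le_measure_integral => // S mS /=.
  by rewrite /mscale/mrestr /pushforward /=; exact: lebesgue_preimage_radius.
by apply: ge0_subset_integral.
Qed.

Let RR : measurableType _ := measurableTypeR R.

Notation mu2 := (mu \x mu)%E.

Lemma lebesgue2_sigma_finite : sigma_finite setT mu2.
Proof.
have /sigma_finiteP[F [TF ndF Foo]] := sigma_finiteT mu.
exists (fun n => F n `*` F n).
  apply/seteqP; split => // -[x y] _.
  have [n _ Fn] : (\bigcup_i F i) x by rewrite -TF.
  have [k _ Fk] : (\bigcup_i F i) y by rewrite -TF.
  exists (maxn n k) => //; split => /=.
    by move: x Fn; exact/subsetPset/ndF/leq_maxl.
  by move: y Fk; exact/subsetPset/ndF/leq_maxr.
move=> k; have [mF Fk] := Foo k; split; first exact: measurableX.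
by rewrite product_measure1E// lte_mul_pinfty// ge0_fin_numE.
Qed.

(* The library's generic sigma-finite structure on product measures is
   shadowed by the one on products of subprobabilities. *)
Definition lebesgue_measure2 : {sigma_finite_measure set (RR * RR)%type -> \bar R} :=
  HB.pack mu2 (Measure_isSigmaFinite.Build _ _ _ mu2 lebesgue2_sigma_finite).

Lemma ge0_integral_lebesgue3 (G : RR * RR * RR -> \bar R) :
  measurable_fun setT G -> (forall x, 0 <= G x)%E ->
  (\int[@lebesgue_measure3 R]_x G x = \int[lebesgue_measure2]_z \int[mu]_y G (z, y))%E.
Proof.
move=> mG G0.
by have -> := @fubini_tonelli1 _ _ (RR * RR)%type RR R lebesgue_measure2 mu G mG G0.
Qed.

Let rho (z : RR * RR) : RR := z.1 ^+ 2 + z.2 ^+ 2.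

Let rho_ge0 z : 0 <= rho z. Proof. by rewrite addr_ge0 ?sqr_ge0. Qed.

Let measurable_sqrt : measurable_fun setT (Num.sqrt : RR -> RR).
Proof. by apply: continuous_measurable_fun; exact: sqrt_continuous. Qed.

Let measurable_rho : measurable_fun setT rho.
Proof. by apply: measurable_funD; apply: measurable_funX. Qed.

Lemma measurable_enorm3 : measurable_fun setT (@enorm3 R : RR * RR * RR -> RR).
Proof.
have -> : @enorm3 R = Num.sqrt \o ((rho \o fst) \+ (fun x => x.2 ^+ 2)) by [].
apply: (measurableT_comp measurable_sqrt).
by apply: measurable_funD; [exact: (measurableT_comp measurable_rho)|apply: measurable_funX].
Qed.

(** One half of polar coordinates, with a loose constant, is enough to transfer finiteness from R^3
    to the half-line. Lines along the third coordinate are compared with half-lines of radii; after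
    exchanging the integrals, the radius [r] is counted once for each point [z] of the disc
    [|z| < r]. *)
Lemma ge0_integral_radial (G : RR -> \bar R) :
  measurable_fun setT G -> (forall r, 0 <= G r)%E ->
  (\int[mu]_(r in `]0%R, +oo[) (((r / 2) ^+ 2)%:E * G r) <=
   2%:E * \int[@lebesgue_measure3 R]_x G (enorm3 x))%E.
Proof.
move=> mG G0.
have mGe : measurable_fun setT (fun x : RR * RR * RR => G (enorm3 x)).
  exact: (measurableT_comp mG measurable_enorm3).
rewrite (@ge0_integral_lebesgue3 (fun x => G (enorm3 x)))//.
pose A : set (RR * RR * RR) := [set w | Num.sqrt (rho w.1) < w.2].
have mA : measurable A.
  have -> : A = (fun w => w.2 - Num.sqrt (rho w.1)) @^-1` `]0, +oo[.
    by apply/seteqP; split => w /=; rewrite in_itv/= andbT subr_gt0.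
  rewrite -[_ @^-1` _]setTI.
  have mf : measurable_fun setT (fun w : RR * RR * RR => w.2 - Num.sqrt (rho w.1) : RR).
    apply: measurable_funB => //; apply: (measurableT_comp measurable_sqrt).
    exact: measurableT_comp.
  by apply: mf.
pose F (w : RR * RR * RR) := (G w.2 * (\1_A w)%:E)%E.
have mF : measurable_fun setT F.
  apply: emeasurable_funM; first exact: measurableT_comp.
  by apply/measurable_EFinP; exact: measurable_indic.
have F0 w : (0 <= F w)%E by rewrite mule_ge0.
apply: (@le_trans _ _ (\int[lebesgue_measure2]_z \int[mu]_r F (z, r))%E); last first.
  have mGe' := @measurable_fun_fubini_tonelli_F _ _ (RR * RR)%type RR R mu _ mGe (fun x => G0 _).
  rewrite -ge0_integralZl//; last first.
    by move=> z _; apply: integral_ge0.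
  apply: ge0_le_integral => //.
  - by move=> z _; apply: integral_ge0.
  - exact: (@measurable_fun_fubini_tonelli_F _ _ (RR * RR)%type RR R mu F mF F0).
  - exact: emeasurable_funM.
  move=> z _ /=.
  have := @ge0_integral_radius (rho z) G (rho_ge0 z) mG G0.
  rewrite integral_mkcond; apply: le_trans.
  rewrite le_eqVlt; apply/orP; left; apply/eqP; apply: eq_integral => r _.
  rewrite /F /patch indicE /=.
  have -> : ((z, r) \in A) = (r \in `]Num.sqrt (rho z), +oo[%classic).
    by apply/idP/idP; rewrite !inE/= in_itv/= andbT.
  by case: ifP; rewrite ?mule1 ?mule0.
rewrite (@fubini_tonelli _ _ (RR * RR)%type RR R lebesgue_measure2 mu F mF F0).
rewrite integral_mkcond; apply: ge0_le_integral => //.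
- move=> r _; rewrite /patch; case: ifP => // _.
  by rewrite mule_ge0// lee_fin sqr_ge0.
- apply/measurable_restrict => //; apply: measurable_funTS.
  apply: emeasurable_funM => //; apply/measurable_EFinP.
  by apply: measurable_funX; apply: measurable_funM.
- exact: (@measurable_fun_fubini_tonelli_G _ _ (RR * RR)%type RR R lebesgue_measure2 F mF F0).
move=> r _; rewrite /patch; case: ifPn => [|_]; last exact: integral_ge0.
rewrite inE/= in_itv/= andbT => r0.
(* A square inside the disc [|z| < r], whose area [(r / 2)^2] is the weight of the statement. *)
pose B : set (RR * RR) := `[0, r / 2]%classic `*` `[0, r / 2]%classic.
have mB : measurable B by exact: measurableX.
have BA : forall z, z \in B -> A (z, r).
  move=> z; rewrite inE => -[/=]; rewrite !in_itv/= => /andP[z10 z1] /andP[z20 z2].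
  rewrite /A/= -[ltRHS](ger0_norm (ltW r0)) -sqrtr_sqr ltr_sqrt ?exprn_gt0//.
  rewrite /rho; nra.
apply: (@le_trans _ _ (\int[lebesgue_measure2]_z (G r * (\1_B z)%:E))%E); last first.
  apply: ge0_le_integral => //.
  - by move=> z _; rewrite mule_ge0.
  - by apply: emeasurable_funM => //; apply/measurable_EFinP; exact: measurable_indic.
  - exact: (measurableT_comp mF (pair2_measurable r)).
  - move=> z _; rewrite /F/= lee_wpmul2l// lee_fin !indicE.
    have [zB|//] := boolP (z \in B).
    by rewrite mem_set//; exact: BA.
rewrite ge0_integralZl//; last first.
  by apply/measurable_EFinP; exact: measurable_indic.
rewrite integral_indic// setIT muleC.
rewrite [X in (_ <= G r * X)%E](_ : _ = ((r / 2) ^+ 2)%:E)//.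
have E : @lebesgue_measure R `[0, r / 2] = (r / 2)%:E.
  by rewrite lebesgue_measure_itv/= lte_fin divr_gt0// -EFinB subr0.
have P := @product_measure1E _ _ RR RR R mu mu `[0, r / 2]%classic `[0, r / 2]%classic.
etransitivity; first by apply: P; exact: measurable_itv.
by rewrite expr2 EFinM; congr (_ * _)%E; exact: E.
Qed.

(** The inverse of [radius s] need not be Lipschitz near 0 or uniformly so at infinity. On each
    slice [1/(n+1) < x < n+1] it is, because [|x - y| (x + y)] is the difference of the squared
    radii; countably many slices, their reflections and the point 0 cover the line. *)
Lemma null_preimage_radius (s : R) (N : set RR) : 0 <= s -> mu N = 0%E ->
  mu (radius s @^-1` N) = 0%E.
Proof.
move=> s0 N0.
pose Z (n : nat) : set R := radius s @^-1` N `&` [set x | n.+1%:R^-1 < x < n.+1%:R].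
have lip n (x y : R) : n.+1%:R^-1 < x < n.+1%:R -> n.+1%:R^-1 < y < n.+1%:R ->
    `|x - y| <= n.+1%:R * Num.sqrt (s + n.+1%:R ^+ 2) * `|radius s x - radius s y|.
  set M := Num.sqrt _; set c : R := n.+1%:R => /andP[x0 x1] /andP[y0 y1].
  have c0 : 0 < c by rewrite ltr0n.
  have ci0 : 0 < c^-1 by rewrite invr_gt0.
  have hM t : c^-1 < t -> t < c -> 0 < radius s t <= M.
    move=> t0 t1; apply/andP; split.
      by apply: lt_le_trans (radius_ge t s0); rewrite normr_gt0 gt_eqF// (lt_trans ci0).
    rewrite ler_sqrt ?addr_ge0 ?sqr_ge0// lerD2l lerXn2r ?nnegrE ?(ltW c0) ?(ltW t1)//.
    by rewrite ltW// (lt_trans ci0).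
  have /andP[hx0 hxM] := hM _ x0 x1; have /andP[hy0 hyM] := hM _ y0 y1.
  have E := radius_diff x y s0.
  have xy0 : 0 < x + y by rewrite addr_gt0// (lt_trans ci0).
  rewrite (gtr0_norm xy0) in E.
  have xyc : 2 <= c * (x + y).
    have -> : (2 : R) = c * (c^-1 + c^-1) by rewrite mulrDr divff ?gt_eqF//.
    by rewrite ler_pM2l// lerD// ltW.
  have H1 : 2 * `|x - y| <= c * (`|x - y| * (x + y)).
    by rewrite mulrCA mulrC ler_wpM2l.
  rewrite -E in H1.
  have H2 : c * (`|radius s x - radius s y| * (radius s x + radius s y)) <=
      c * (`|radius s x - radius s y| * (2 * M)).
    by rewrite ler_pM2l// ler_wpM2l//; lra.
  rewrite -mulrA [M * _]mulrC.
  by move: H1 H2; rewrite [_ * (2 * M)]mulrCA [c * (2 * _)]mulrCA; lra.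
(* The sign [e = -1] reaches the negative half-line, [radius s] being even. *)
have null n (e : R) : e = 1 \/ e = -1 -> mu ((fun x => e * x) @` Z n) = 0%E.
  move=> e1; apply/eqP; rewrite eq_le outer_measure_ge0 andbT.
  have K0 : 0 < n.+1%:R * Num.sqrt (s + n.+1%:R ^+ 2) :> R.
    by rewrite mulr_gt0// sqrtr_gt0 ltr_wpDl// exprn_gt0.
  have H t t' : Z n t -> Z n t' -> `|e * t - e * t'| <=
      (n.+1%:R * Num.sqrt (s + n.+1%:R ^+ 2)) * `|radius s t - radius s t'|.
    move=> [_ zt] [_ zt']; rewrite -mulrBr normrM.
    have -> : `|e| = 1 by case: e1 => ->; rewrite ?normrN normr1.
    by rewrite mul1r lip.
  apply: (le_trans (lebesgue_measure_lipschitz K0 H)).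
  rewrite [X in (_ * X)%E](_ : _ = 0%E) ?mule0//.
  apply/eqP; rewrite eq_le outer_measure_ge0 andbT -N0.
  by apply: le_outer_measure => _ [x [Nx _] <-].
apply/eqP; rewrite eq_le outer_measure_ge0 andbT.
pose C n := ((fun x => 1 * x) @` Z n) `|` ((fun x => -1 * x) @` Z n) `|` [set 0].
have ZC : radius s @^-1` N `<=` \bigcup_n C n.
  move=> x Nx; have [->|x0] := eqVneq x 0; first by exists 0%N => //; right.
  have y0 : 0 < `|x| by rewrite normr_gt0.
  pose n := Num.truncn (`|x| + `|x|^-1).
  have nb : `|x| + `|x|^-1 < n.+1%:R by exact: truncnS_gt.
  have yi0 : 0 < `|x|^-1 by rewrite invr_gt0.
  have Zx : Z n `|x|.
    split; first by rewrite /= /radius real_normK ?num_real.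
    apply/andP; split; last by lra.
    by rewrite -[ltRHS]invrK ltf_pV2 ?posrE//; lra.
  exists n => //; left.
  have [xp|xn] := leP 0 x.
    by left; exists x; rewrite ?mul1r// -[X in Z n X](ger0_norm xp).
  by right; exists (- x); rewrite ?mulN1r ?opprK// -[X in Z n X](ltr0_norm xn).
apply: (le_trans (le_outer_measure mu _ _ ZC)).
apply: (le_trans (outer_measure_sigma_subadditive mu C)).
rewrite eseries0// => n _ _; apply/eqP; rewrite eq_le outer_measure_ge0 andbT.
rewrite /C; apply: (le_trans (outer_measureU2 _ _ _)).
rewrite [X in (_ + X)%E](_ : _ = 0%E) ?adde0; last exact: lebesgue_measure_set1.
apply: (le_trans (outer_measureU2 _ _ _)).
have n1 := null n 1 (or_introl erefl); have n2 := null n (-1) (or_intror erefl).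
by rewrite [X in (X + _)%E](_ : _ = 0%E) ?add0e// [leLHS](_ : _ = 0%E).
Qed.

(** All sections of the preimage of [N] along the last coordinate are null, hence so is the
    preimage. This carries an almost everywhere statement about radii to R^3. *)
Lemma ae_radial (N : set RR) : measurable N -> mu N = 0%E ->
  {ae @lebesgue_measure3 R, forall x, ~ N (enorm3 x)}.
Proof.
move=> mN N0.
have mE : measurable ((@enorm3 R : RR * RR * RR -> RR) @^-1` N).
  by rewrite -[_ @^-1` _]setTI; apply: measurable_enorm3.
exists ((@enorm3 R : RR * RR * RR -> RR) @^-1` N); split => //.
  have H z : (setT : set (RR * RR)) z ->
      (mu \o xsection ((@enorm3 R : RR * RR * RR -> RR) @^-1` N)) z = 0%E.
    move=> _; rewrite /= -[RHS](null_preimage_radius (rho_ge0 z) N0); congr (mu _).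
    by apply/seteqP; split => y; rewrite /xsection/= inE.
  exact: (@integral0_eq _ _ _ lebesgue_measure2 _ _ H).
by move=> x /= /contrapT.
Qed.

End RadialMeasure.

(** * Absolutely continuous functions *)

Section AbsolutelyContinuous.
Variable R : realType.
Notation mu := (@lebesgue_measure R).
Implicit Types (f g u v : R -> R).

Lemma Rintegral_cat f (a b c : R) : a <= b -> b <= c ->
  mu.-integrable `[a, c] (EFin \o f) ->
  \int[mu]_(x in `[a, c]) f x =
  \int[mu]_(x in `[a, b]) f x + \int[mu]_(x in `[b, c]) f x.
Proof.
move=> ab bc fi; rewrite -[X in _ = _ + X]Rintegral_itv_obnd_cbnd; last first.
  by apply: integrableS fi => //; apply: subset_itv; rewrite bnd_simp.
rewrite -(@Rintegral_itvB _ _ (BLeft a) (BRight c) b fi) ?bnd_simp//.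
by rewrite addrC subrK.
Qed.

Lemma ac_within_continuous u v (s t : R) : ac_derivative u v -> 0 < s -> s <= t ->
  {within `[s, t], continuous u}.
Proof.
move=> uv s0 st; have [vi _] := uv _ _ s0 st.
have c := parameterized_integral_continuous st vi.
apply: (@subspace_eq_continuous _ _ _ (fun y => u s + parameterized_integral mu s y v)).
  move=> y; rewrite inE/= in_itv/= => /andP[sy _]; have [_ E] := uv _ _ s0 sy.
  by rewrite /from_subspace /parameterized_integral -E addrC subrK.
by move=> x; apply: cvgD; [exact: cvg_cst|exact: c].
Qed.

Lemma ac_continuous u v (x : R) : ac_derivative u v -> 0 < x -> {for x, continuous u}.
Proof.
move=> uv x0; have h0 : 0 < x / 2 by rewrite divr_gt0.
have h1 : x / 2 < x * 2 by lra.
apply: (within_continuous_continuous h1 (ac_within_continuous uv h0 (ltW h1))).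
by rewrite in_itv/=; lra.
Qed.

Lemma integrable_addr (D : set R) f g : measurable D ->
  mu.-integrable D (EFin \o f) -> mu.-integrable D (EFin \o g) ->
  mu.-integrable D (EFin \o (fun x => f x + g x)).
Proof.
move=> mD fi gi.
by rewrite (_ : _ \o _ = (EFin \o f) \+ (EFin \o g))%E//; exact: integrableD.
Qed.

Lemma integrable_subr (D : set R) f g : measurable D ->
  mu.-integrable D (EFin \o f) -> mu.-integrable D (EFin \o g) ->
  mu.-integrable D (EFin \o (fun x => f x - g x)).
Proof.
move=> mD fi gi.
by rewrite (_ : _ \o _ = (EFin \o f) \- (EFin \o g))%E//; exact: integrableB.
Qed.

Lemma integrable_scaler (D : set R) f (c : R) : measurable D ->
  mu.-integrable D (EFin \o f) -> mu.-integrable D (EFin \o (fun x => c * f x)).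
Proof.
move=> mD fi.
by rewrite (_ : _ \o _ = (fun x => c%:E * (EFin \o f) x)%E)//; exact: integrableZl.
Qed.

Lemma integrable_normr (D : set R) f : measurable D ->
  mu.-integrable D (EFin \o f) -> mu.-integrable D (EFin \o (fun x => `|f x|)).
Proof. by move=> mD /integrable_norm. Qed.

Lemma integrable_le (D : set R) f g : measurable D -> measurable_fun D f ->
  mu.-integrable D (EFin \o g) -> (forall x, D x -> `|f x| <= g x) ->
  mu.-integrable D (EFin \o f).
Proof.
move=> mD mf gi fg; apply: le_integrable gi => //; first exact/measurable_EFinP.
by move=> x Dx /=; rewrite lee_fin (le_trans (fg _ Dx))// ler_norm.
Qed.

Lemma integrableMl_le (D : set R) f g (K : R) : measurable D -> measurable_fun D f ->
  mu.-integrable D (EFin \o g) -> (forall x, D x -> `|f x| <= K) ->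
  mu.-integrable D (EFin \o (fun x => f x * g x)).
Proof.
move=> mD mf gi fK; apply: (@integrable_le _ _ (fun x => K * `|g x|)) => //.
- apply: measurable_funM => //.
  by apply/measurable_EFinP; exact: measurable_int gi.
- exact/integrable_scaler/integrable_normr.
- by move=> x Dx; rewrite normrM ler_wpM2r// fK.
Qed.

Lemma continuous_bounded f (a b : R) : {within `[a, b], continuous f} ->
  exists K, forall x, a <= x <= b -> `|f x| <= K.
Proof.
move=> cf; have [ab|ba] := leP a b; last first.
  by exists 0 => x /andP[/le_trans h /h]; rewrite leNgt ba.
have cn : {within `[a, b], continuous (fun x => `|f x|)}.
  by move=> x; apply: continuous_comp; [exact: cf|exact: norm_continuous].
by have [c _ cmax] := EVT_max ab cn; exists `|f c| => x xab; apply: cmax; rewrite in_itv.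
Qed.

Lemma integrable_mul_continuous f g (a b : R) :
  {within `[a, b], continuous f} -> mu.-integrable `[a, b] (EFin \o g) ->
  mu.-integrable `[a, b] (EFin \o (fun x => f x * g x)).
Proof.
move=> cf gi; have [K fK] := continuous_bounded cf.
apply: (@integrableMl_le _ _ _ K) => //.
by apply: subspace_continuous_measurable_fun => //; exact: measurable_itv.
Qed.

(* [u v] increases on [a, b] by the integral of [u' v(b) + u(a) v'], so the
   defect [D] below is additive and [o(N)] on short intervals, hence zero. *)
Lemma ac_mul u u' v v' : ac_derivative u u' -> ac_derivative v v' ->
  ac_derivative (fun x => u x * v x) (fun x => u' x * v x + u x * v' x).
Proof.
move=> uu' vv'.
have int_uv a b : 0 < a -> a <= b ->
    mu.-integrable `[a, b] (EFin \o (fun x => u x * v' x)).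
  move=> a0 ab; have [vi _] := vv' _ _ a0 ab.
  by apply: integrable_mul_continuous => //; apply: ac_within_continuous uu' _ _.
have int_vu a b : 0 < a -> a <= b ->
    mu.-integrable `[a, b] (EFin \o (fun x => u' x * v x)).
  move=> a0 ab; have [ui _] := uu' _ _ a0 ab.
  rewrite (_ : (fun x => u' x * v x) = (fun x => v x * u' x)); last first.
    by apply/funext => x; rewrite mulrC.
  by apply: integrable_mul_continuous => //; apply: ac_within_continuous vv' _ _.
have int_ab a b : 0 < a -> a <= b ->
    mu.-integrable `[a, b] (EFin \o (fun x => u' x * v x + u x * v' x)).
  move=> a0 ab.
  by apply: integrable_addr => //; [exact: int_vu|exact: int_uv].
have int_n a b : 0 < a -> a <= b ->
    mu.-integrable `[a, b] (EFin \o (fun x => `|u' x| + `|v' x|)).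
  move=> a0 ab; have [ui _] := uu' _ _ a0 ab; have [vi _] := vv' _ _ a0 ab.
  by apply: integrable_addr => //; exact: integrable_normr.
move=> s t s0 st; split; first exact: int_ab.
pose D a b := u b * v b - u a * v a - \int[mu]_(x in `[a, b]) (u' x * v x + u x * v' x).
pose N a b := \int[mu]_(x in `[a, b]) (`|u' x| + `|v' x|).
have D_cat a b c : 0 < a -> a <= b -> b <= c -> D a c = D a b + D b c.
  move=> a0 ab bc; rewrite /D (@Rintegral_cat _ a b c)//; first by ring.
  by apply: int_ab => //; exact: le_trans bc.
have N_cat a b c : 0 < a -> a <= b -> b <= c -> N a c = N a b + N b c.
  move=> a0 ab bc; rewrite /N (@Rintegral_cat _ a b c)//.
  by apply: int_n => //; exact: le_trans bc.
suff H e : 0 < e -> `|D s t| <= e * N s t.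
  have : `|D s t| <= 0.
    apply/ler_addgt0Pr => e e0; rewrite add0r.
    have N0 : 0 <= N s t by apply: Rintegral_ge0 => x _; rewrite addr_ge0.
    apply: (le_trans (H (e / (N s t + 1)) _)); first by rewrite divr_gt0// ltr_wpDl.
    by rewrite -mulrA ger_pMr// mulrC ler_pdivrMr ?mul1r ?lerDl// ltr_wpDl.
  by rewrite normr_le0 subr_eq0 => /eqP.
move=> e0.
have [d1 [d10 hu]] := heine_cantor (ac_within_continuous uu' s0 st) e0.
have [d2 [d20 hv]] := heine_cantor (ac_within_continuous vv' s0 st) e0.
pose d := Num.min d1 d2 / 2.
have d0 : 0 < d by rewrite divr_gt0// lt_min d10 d20.
have dd1 : d < d1.
  have : Num.min d1 d2 <= d1 by rewrite ge_min lexx.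
  by rewrite /d; move: d0; rewrite /d; lra.
have dd2 : d < d2.
  have : Num.min d1 d2 <= d2 by rewrite ge_min lexx orbT.
  by rewrite /d; move: d0; rewrite /d; lra.
have short a b : s <= a -> a <= b -> b <= t -> b - a <= d -> `|D a b| <= e * N a b.
  move=> sa ab bt bad; have a0 : 0 < a by exact: lt_le_trans sa.
  have [ui uE] := uu' _ _ a0 ab; have [vi vE] := vv' _ _ a0 ab.
  have i1 : mu.-integrable `[a, b] (EFin \o (fun x => u' x * v b)).
    rewrite (_ : (fun x => _) = (fun x => v b * u' x)); last first.
      by apply/funext => x; rewrite mulrC.
    exact: integrable_scaler.
  have i2 : mu.-integrable `[a, b] (EFin \o (fun x => u a * v' x)).
    exact: integrable_scaler.
  have i12 : mu.-integrable `[a, b] (EFin \o (fun x => u' x * v b + u a * v' x)).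
    exact: integrable_addr.
  have i3 : mu.-integrable `[a, b] (EFin \o (fun x =>
      (u' x * v b + u a * v' x) - (u' x * v x + u x * v' x))).
    by apply: integrable_subr => //; exact: int_ab.
  have -> : D a b = \int[mu]_(x in `[a, b])
      ((u' x * v b + u a * v' x) - (u' x * v x + u x * v' x)).
    rewrite RintegralB//; last exact: int_ab.
    rewrite RintegralD// RintegralZr// RintegralZl// -uE -vE /D.
    by congr (_ - _); ring.
  apply: (le_trans (le_normr_Rintegral _ _)) => //.
  rewrite /N -RintegralZl//; last exact: int_n.
  apply: le_Rintegral => //.
  - exact: integrable_normr.
  - by apply: integrable_scaler => //; exact: int_n.
  - move=> x; rewrite /= in_itv/= => /andP[ax xb].
    (* Only increments of [u] and [v] over a short interval remain as factors, each at most [e]. *)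
    have -> : u' x * v b + u a * v' x - (u' x * v x + u x * v' x) =
      u' x * (v b - v x) + (u a - u x) * v' x by ring.
    apply: (le_trans (ler_normD _ _)); rewrite !normrM mulrDr lerD//.
      rewrite mulrC ler_wpM2r// hv//.
      + by rewrite (le_trans sa)// bt.
      + by rewrite (le_trans sa)//= (le_trans xb).
      + by rewrite ger0_norm ?subr_ge0//; apply: le_lt_trans dd2; lra.
    rewrite ler_wpM2r// hu//.
    + by rewrite sa/= (le_trans ab).
    + by rewrite (le_trans sa)//= (le_trans xb).
    + by rewrite ler0_norm ?subr_le0// opprB; apply: le_lt_trans dd1; lra.
have chain : forall (n : nat) b, s <= b -> b <= t -> b - s <= n%:R * d ->
    `|D s b| <= e * N s b.
  elim=> [|n IH] b sb bt bn.
    have bs : b = s by apply/eqP; rewrite eq_le sb andbT; lra.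
    by apply: short => //; rewrite bs subrr ltW.
  have [bd|bd] := leP (b - s) d; first exact: short.
  have h1 : s <= b - d by lra.
  have h2 : b - d <= b by lra.
  have h3 : b - d <= t by lra.
  rewrite (D_cat s (b - d) b)// (N_cat s (b - d) b)// mulrDr.
  apply: (le_trans (ler_normD _ _)); apply: lerD.
    by apply: IH => //; move: bn; rewrite -natr1; lra.
  by apply: short => //; lra.
have tn : t - s <= (Num.truncn ((t - s) / d)).+1%:R * d.
  by rewrite -ler_pdivrMr//; apply/ltW/truncnS_gt.
exact: chain tn.
Qed.

Lemma ac_C1 g g' : (forall x : R, 0 < x -> is_derive x 1 g (g' x)) ->
  (forall x : R, 0 < x -> {for x, continuous g'}) -> ac_derivative g g'.
Proof.
move=> dg cg s t s0 st.
have pos x : s <= x -> 0 < x by exact: lt_le_trans.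
have cw : {within `[s, t], continuous g'}.
  apply: continuous_in_subspaceT => x; rewrite inE/= in_itv/= => /andP[sx _].
  exact/cg/pos.
have gi : mu.-integrable `[s, t] (EFin \o g').
  by apply: continuous_compact_integrable => //; exact: segment_compact.
split => //.
move: st; rewrite le_eqVlt => /predU1P[<-|st].
  by rewrite subrr set_itv1 Rintegral_set1.
rewrite /Rintegral (@continuous_FTC2 _ g' g)//.
- split => [x|//|//].
  + by rewrite in_itv/= => /andP[/ltW/pos/dg[]].
  + have /derivable1_diffP/differentiable_continuous := @ex_derive _ _ _ _ _ _ _ (dg s s0).
    exact: cvg_at_right_filter.
  + have := @ex_derive _ _ _ _ _ _ _ (dg t (pos _ (ltW st))).
    by move=> /derivable1_diffP/differentiable_continuous; exact: cvg_at_left_filter.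
- by move=> x; rewrite in_itv/= => /andP[/ltW/pos/dg h _]; rewrite derive1E derive_val.
Qed.

End AbsolutelyContinuous.

(** * Regular solutions *)

Section Solutions.
Variable R : realType.
Notation mu := (@lebesgue_measure R).
Implicit Types (q f g u v phi m : R -> R).

Lemma ac_sub u u' v v' : ac_derivative u u' -> ac_derivative v v' ->
  ac_derivative (fun x => u x - v x) (fun x => u' x - v' x).
Proof.
move=> uu' vv' s t s0 st; have [ui uE] := uu' _ _ s0 st; have [vi vE] := vv' _ _ s0 st.
split; first exact: integrable_subr.
by rewrite RintegralB// -uE -vE; ring.
Qed.

Lemma ac_scale u u' (c : R) : ac_derivative u u' ->
  ac_derivative (fun x => c * u x) (fun x => c * u' x).
Proof.
move=> uu' s t s0 st; have [ui uE] := uu' _ _ s0 st.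
split; first exact: integrable_scaler.
by rewrite RintegralZl// -uE; ring.
Qed.

(** Integrability of [v'] is assumed separately: agreeing almost everywhere with [v] does not make
    [v'] Borel measurable. *)
Lemma ac_ae u v v' : ac_derivative u v ->
  (forall s t : R, 0 < s -> s <= t -> mu.-integrable `[s, t] (EFin \o v')) ->
  {ae mu, forall r : R, 0 < r -> v r = v' r} -> ac_derivative u v'.
Proof.
move=> uv iv' vv' s t s0 st; have [vi vE] := uv _ _ s0 st; split; first exact: iv'.
rewrite vE /Rintegral; congr fine; apply: ae_eq_integral => //.
- exact: measurable_int vi.
- exact: measurable_int (iv' _ _ s0 st).
- case: vv' => N [mN N0 sub]; exists N; split => // x /= h; apply: sub => /= h'.
  apply: h; rewrite in_itv/= => /andP[sx _].
  by rewrite h'// (lt_le_trans s0).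
Qed.

Lemma Rintegral_oc_cvg0 f (b e : R) : 0 < b -> 0 < e ->
  mu.-integrable `]0, b] (EFin \o f) ->
  exists d : R, [/\ 0 < d, d <= b & forall s, 0 < s <= d -> `|\int[mu]_(x in `]0, s]) f x| <= e].
Proof.
move=> b0 e0 fi.
pose g := f \_ `]0, b].
have gi : mu.-integrable `[0, b] (EFin \o g).
  rewrite -restrict_EFin; apply/integrable_restrict => //=; rewrite setIidr//.
  exact: subset_itv_oc_cc.
have /cvgrPdist_le/(_ _ e0) := parameterized_integral_cvg_left b0 gi.
move=> /nbhs_ballP[d /= d0 hd].
exists (Num.min (d / 2) b); split.
- by rewrite lt_min divr_gt0.
- by rewrite ge_min lexx orbT.
move=> s /andP[s0]; rewrite le_min => /andP[sd sb].
have := hd s; rewrite /ball/= sub0r normrN gtr0_norm// => /(_ _).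
rewrite sub0r normrN /parameterized_integral.
have -> : \int[mu]_(x in `[0, s]) g x = \int[mu]_(x in `]0, s]) f x.
  rewrite /g -Rintegral_mkcondr.
  congr Rintegral.
  apply/seteqP; split => x /=; rewrite !in_itv/=.
    by move=> [/andP[x0 xs] /andP[-> _]].
  by move=> /andP[x0 xs]; rewrite x0 xs (ltW x0) (le_trans xs).
by apply; lra.
Qed.

(** Integrability of [v] up to 0 already forces a limit of [u] at 0, so smallness at some points
    arbitrarily close to 0 identifies it; a mean value theorem provides no more than such points. *)
Lemma ac_vanishing u v (r : R) : 0 < r -> ac_derivative u v ->
  mu.-integrable `]0, r] (EFin \o v) ->
  (forall e d : R, 0 < e -> 0 < d -> exists s, 0 < s < d /\ `|u s| <= e) ->
  u r = \int[mu]_(t in `]0, r]) v t.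
Proof.
move=> r0 uv vi u0.
have split_r (s : R) : 0 < s -> s <= r ->
    u r - u s = \int[mu]_(t in `]0, r]) v t - \int[mu]_(t in `]0, s]) v t.
  move=> s0 sr; have [_ ->] := uv _ _ s0 sr.
  rewrite -Rintegral_itv_obnd_cbnd; last first.
    apply: (integrableS _ _ _ vi) => //.
    by apply: subset_itvr; rewrite bnd_simp ltW.
  by rewrite (@Rintegral_itvB _ _ (BRight 0) (BRight r) s vi)// ?bnd_simp// ltW.
apply/eqP; rewrite -subr_eq0 -normr_le0; apply/ler_addgt0Pr => e e0; rewrite add0r.
have e2 : 0 < e / 2 by rewrite divr_gt0.
have [d [d0 dr hd]] := Rintegral_oc_cvg0 r0 e2 vi.
have [s [/andP[s0 sd] us]] := u0 _ _ e2 d0.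
have Is : `|\int[mu]_(t in `]0, s]) v t| <= e / 2 by apply: hd; rewrite s0 ltW.
have sr : s <= r by exact: le_trans (ltW sd) dr.
have := split_r s s0 sr.
move: us Is.
move: (\int[mu]_(t in `]0, s]) v t) (\int[mu]_(t in `]0, r]) v t) (u s) (u r).
move=> I1 I2 u1 u2 h1 h2 h3.
have -> : u2 - I2 = u1 - I1 by lra.
by apply: (le_trans (ler_normB _ _)); lra.
Qed.

Lemma is_derive_expr (n : nat) (x : R) :
  is_derive x 1 (fun r : R => r ^+ n) (n%:R * x ^+ n.-1).
Proof.
have h := @is_deriveX _ _ (@id R) n x 1 1 _.
rewrite (_ : (fun r => r ^+ n) = (@id R) ^+ n); last by apply/funext => r; rewrite exprfctE.
by apply: is_derive_eq; rewrite /GRing.scale/= mulr1.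
Qed.

Lemma continuous_expr (n : nat) (c x : R) : {for x, continuous (fun r : R => c * r ^+ n)}.
Proof. by apply: cvgM; [exact: cvg_cst|exact: exprn_continuous]. Qed.

Lemma ac_expr (n : nat) : ac_derivative (fun r : R => r ^+ n) (fun r => n%:R * r ^+ n.-1).
Proof.
apply: ac_C1 => x x0; first exact: is_derive_expr.
exact: continuous_expr.
Qed.

(* The equation of [m = (2l+1)!! phi_l / r^(l+1)], for [k = 2l+1]. *)
Definition normalized_solution q (k : nat) m : Prop :=
  [/\ forall r : R, 0 < r -> mu.-integrable `]0, r]
        (EFin \o (fun t => t ^+ k.+1 * ((q t - 1) * m t))),
      forall r : R, 0 < r -> is_derive r 1 m
        (r ^- k.+1 * \int[mu]_(t in `]0, r]) (t ^+ k.+1 * ((q t - 1) * m t)))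
    & m r @[r --> 0^'+] --> (1 : R)].

Lemma cvg1_bounded m (b : R) : 0 < b -> (forall r : R, 0 < r -> {for r, continuous m}) ->
  m r @[r --> 0^'+] --> (1 : R) -> exists K, forall r, 0 < r <= b -> `|m r| <= K.
Proof.
move=> b0 cm m1.
have [d [d0 hd]] : exists d : R, 0 < d /\ forall r, 0 < r < d -> `|m r| <= 2.
  move/cvgrPdist_le : m1 => /(_ 1 ltr01); rewrite near_withinE => /nbhs_ballP[d /= d0 hd].
  exists d; split => // r /andP[r0 rd].
  have := hd r; rewrite /ball/= sub0r normrN gtr0_norm// => /(_ rd r0) h.
  have -> : m r = 1 - (1 - m r) by ring.
  by apply: (le_trans (ler_normB _ _)); rewrite normr1; lra.
have [K hK] : exists K, forall r, d / 2 <= r <= b -> `|m r| <= K.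
  apply: continuous_bounded; apply: continuous_in_subspaceT => x.
  rewrite inE/= in_itv/= => /andP[dx _]; apply: cm; apply: lt_le_trans dx.
  by rewrite divr_gt0.
exists (Num.max 2 K) => r /andP[r0 rb]; rewrite le_max.
have [rd|rd] := ltP r d; first by rewrite hd ?r0.
by rewrite hK ?orbT// rb andbT; lra.
Qed.

Lemma measurable_continuous_pos m (b : R) :
  (forall r : R, 0 < r -> {for r, continuous m}) ->
  measurable_fun `]0, b] (m : measurableTypeR R -> measurableTypeR R).
Proof.
move=> cm.
apply: (@measurable_funS _ _ (measurableTypeR R) (measurableTypeR R) `]0%R, +oo[%classic) => //.
  by move=> x; rewrite /= !in_itv/= andbT => /andP[].
apply: open_continuous_measurable_fun; first exact: interval_open.
by move=> x; rewrite inE/= in_itv/= andbT => /cm.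
Qed.

(** * The integral equation of a regular solution *)

Section Regular.
Variables (q : R -> R) (l : nat) (phi : R -> R).
Hypothesis iq : forall b : R, 0 < b ->
  mu.-integrable `]0, b] (EFin \o (fun t => t ^+ 2 * q t)).
Hypothesis phi_reg : regular_solution q l phi.

Let c : R := (odd_dfact l)%:R.
Let m r := c * phi r / r ^+ l.+1.
(** This is [r^(2l+2) m']: in the divergence form [(r^(2l+2) m')' = r^(2l+2) (q - 1) m] of the
    equation the centrifugal term has disappeared. *)
Let u r := c * (r ^+ l.+1 * derive1 phi r - l.+1%:R * r ^+ l * phi r).

Lemma odd_dfact_gt0 : 0 < c.
Proof.
by rewrite ltr0n /odd_dfact prodn_gt0// => i; rewrite addn1.
Qed.

Lemma phi_is_derive (r : R) : 0 < r -> is_derive r 1 phi (derive1 phi r).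
Proof.
move=> r0; have [[dphi _] _] := phi_reg; have d := dphi r r0.
by rewrite derive1E; exact: DeriveDef.
Qed.

Lemma dphi_continuous (r : R) : 0 < r -> {for r, continuous (derive1 phi)}.
Proof.
by have [[_ [phi2 h _]] _] := phi_reg; exact: ac_continuous h.
Qed.

Lemma m_is_derive (r : R) : 0 < r -> is_derive r 1 m (r ^- l.*2.+2 * u r).
Proof.
move=> r0.
have r1 : r ^+ l.+1 != 0 by rewrite gt_eqF// exprn_gt0.
have d1 := phi_is_derive r0.
have d2 := is_derive_expr l.+1 r.
rewrite (_ : m = (c \*: phi) * (fun r => (r ^+ l.+1)^-1)); last by [].
have d3 : is_derive r 1 (fun r : R => (r ^+ l.+1)^-1) (- (l.+1%:R * r ^+ l) / (r ^+ l.+1) ^+ 2).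
  have := @is_deriveV R (fun r : R => r ^+ l.+1) r _ 1 r1 d2; rewrite /GRing.scale/=.
  rewrite (_ : - r ^+ l.+1 ^- 2 * _ = - (l.+1%:R * r ^+ l) / r ^+ l.+1 ^+ 2)//=.
  by rewrite mulNr mulNr mulrC.
apply: is_derive_eq.
rewrite /GRing.scale/= /u.
have E : r ^+ l.*2.+2 = r ^+ l.+1 * r ^+ l.+1 by rewrite -exprD; congr (_ ^+ _); lia.
have rl : r ^+ l != 0 by rewrite gt_eqF// exprn_gt0.
have rn : r != 0 by rewrite gt_eqF.
have -> : c *: phi r = c * phi r by [].
rewrite E !exprS; move: (l.+1%:R) (r ^+ l) rl => n p p0.
by field; rewrite rn p0.
Qed.

Lemma m_cvg1 : m r @[r --> 0^'+] --> (1 : R).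
Proof.
have [_ /eqaddoP E] := phi_reg.
apply/cvgrPdist_le => e e0.
have c0 := odd_dfact_gt0.
have /E : 0 < e / c by rewrite divr_gt0.
apply: filterS2 (nbhs_right_gt 0) => r r0 /=.
rewrite !fctE /m => h.
have r1 : 0 < r ^+ l.+1 by rewrite exprn_gt0.
rewrite (gtr0_norm r1) in h.
have -> : 1 - c * phi r / r ^+ l.+1 = - (c / r ^+ l.+1 * (phi r - r ^+ l.+1 / c)).
  by field; rewrite !gt_eqF.
rewrite normrN normrM gtr0_norm ?divr_gt0//.
have -> : e = c / r ^+ l.+1 * (e / c * r ^+ l.+1) by field; rewrite !gt_eqF.
by rewrite ler_pM2l// divr_gt0.
Qed.

Lemma m_continuous (r : R) : 0 < r -> {for r, continuous m}.
Proof.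
move=> /m_is_derive d; apply: differentiable_continuous.
by apply/derivable1_diffP; case: d.
Qed.

Let dens (t : R) := t ^+ l.*2.+2 * ((q t - 1) * m t).

Lemma dens_integrable (b : R) : 0 < b -> mu.-integrable `]0, b] (EFin \o dens).
Proof.
move=> b0; have [K mK] := cvg1_bounded b0 m_continuous m_cvg1.
rewrite (_ : dens = fun t => (t ^+ l.*2 * m t) * (t ^+ 2 * q t - t ^+ 2)); last first.
  apply/funext => t; rewrite /dens.
  have -> : t ^+ l.*2.+2 = t ^+ l.*2 * t ^+ 2 by rewrite -exprD addn2.
  ring.
apply: (@integrableMl_le _ _ _ _ (b ^+ l.*2 * K)) => //.
- apply: measurable_funM; last exact: (measurable_continuous_pos m_continuous).
  apply: measurable_funTS; apply: continuous_measurable_fun.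
  exact: exprn_continuous.
- apply: integrable_subr => //; first exact: iq.
  apply: (@integrableS _ _ _ mu `[0, b]) => //; first exact: subset_itv_oc_cc.
  apply: continuous_compact_integrable; first exact: segment_compact.
  by apply: continuous_subspaceT => x; exact: exprn_continuous.
- move=> x; rewrite /= in_itv/= => /andP[x0 xb].
  rewrite normrM ler_pM// ?mK ?x0// normrX gtr0_norm//.
  by rewrite lerXn2r// nnegrE ltW// (lt_le_trans x0).
Qed.

Lemma u_ac : ac_derivative u dens.
Proof.
have [[_ [phi2 h ode]] _] := phi_reg.
have hphi : ac_derivative phi (derive1 phi).
  by apply: ac_C1 => x x0; [exact: phi_is_derive|exact: dphi_continuous].
have := ac_scale c (ac_sub (ac_mul (ac_expr l.+1) h)
  (ac_mul (ac_scale l.+1%:R (ac_expr l)) hphi)).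
move=> /ac_ae; apply.
  move=> s t s0 st; apply: (integrableS _ _ _ (dens_integrable (lt_le_trans s0 st))) => //.
  by move=> x; rewrite /= !in_itv/= => /andP[sx ->]; rewrite (lt_le_trans s0).
case: ode => N [mN N0 sub]; exists N; split => // x /= hx; apply: sub => /= e.
apply: hx => x0; have {}e := e x0.
have xl : x ^+ l != 0 by rewrite gt_eqF// exprn_gt0.
have xn : x != 0 by rewrite gt_eqF.
have -> : phi2 x = - phi x + (l * l.+1)%:R / x ^+ 2 * phi x + q x * phi x.
  by move: e; move: (_ / _ * _) (q x * _) => A B; lra.
rewrite /dens /m.
have -> : x ^+ l.*2.+2 = x ^+ l.+1 * x ^+ l.+1 by rewrite -exprD; congr (_ ^+ _); lia.
(* The derivative of [r ^+ l] involves [l.-1], which is truncated at [l = 0]. *)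
case: l xl => [|n].
  by move=> _; rewrite -[(0 * 1)%N]/0%N expr0 expr1; field.
rewrite natrM /= !exprS mulf_eq0 negb_or => /andP[_ p0].
by move: (x ^+ n) (n.+1%:R) (n.+2%:R) p0 => p N1 N2 p0; field; rewrite xn p0.
Qed.

(** Regularity at 0 concerns [phi] alone and not its derivative. The mean value theorem for [m] on
    [[s, 2 s]] gives a point [x] with [u x = x^(2l+2) (m (2 s) - m s) / s], which is small because
    [m] tends to 1 and [x^(2l+2) <= 2 s]. *)
Lemma u_integral (r : R) : 0 < r -> u r = \int[mu]_(t in `]0, r]) dens t.
Proof.
move=> r0; apply: (ac_vanishing r0 u_ac (dens_integrable r0)) => e d e0 d0.
have [d1 [d10 hd1]] : exists d1 : R, 0 < d1 /\ forall s, 0 < s < d1 -> `|1 - m s| <= e / 12.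
  have e12 : 0 < e / 12 by rewrite divr_gt0.
  have /cvgrPdist_le/(_ _ e12) := m_cvg1.
  rewrite near_withinE => /nbhs_ballP[d1 /= d10 hd1].
  exists d1; split => // s /andP[s0 sd].
  by apply: hd1 => //; rewrite /ball/= sub0r normrN gtr0_norm.
pose s := Num.min (Num.min d d1) 1 / 3.
have s0 : 0 < s by rewrite divr_gt0// !lt_min d0 d10 ltr01.
have [sd sd1 s1] : [/\ 3 * s <= d, 3 * s <= d1 & 3 * s <= 1].
  have -> : 3 * s = Num.min (Num.min d d1) 1 by rewrite /s; field.
  by rewrite !ge_min !lexx ?orbT.
have ss : s < 2 * s by lra.
have [] := @MVT _ m (fun r => r ^- l.*2.+2 * u r) s (2 * s) ss.
- by move=> x; rewrite in_itv/= => /andP[sx _]; apply: m_is_derive; exact: lt_trans sx.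
- apply: continuous_in_subspaceT => x; rewrite inE/= in_itv/= => /andP[sx _].
  by apply: m_continuous; exact: lt_le_trans sx.
move=> x; rewrite in_itv/= => /andP[sx xs] mx.
have x0 : 0 < x by exact: lt_trans sx.
have x1 : x <= 1 by lra.
have ux : `|u x| <= e / 3.
  have -> : u x = x ^+ l.*2.+2 * (m (2 * s) - m s) / s.
    rewrite mx; move: (u x) => y; rewrite exprS.
    have : x ^+ l.*2.+1 != 0 by rewrite gt_eqF// exprn_gt0.
    move: (x ^+ _) => p p0; field.
    by rewrite p0 !gt_eqF.
  rewrite normrM normfV (gtr0_norm s0) normrM (ger0_norm (exprn_ge0 _ (ltW x0))).
  rewrite ler_pdivrMr//.
  have h1 : `|m (2 * s) - m s| <= e / 6.
    have -> : m (2 * s) - m s = (1 - m s) - (1 - m (2 * s)) by ring.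
    apply: (le_trans (ler_normB _ _)).
    have a1 : `|1 - m s| <= e / 12 by apply: hd1; rewrite s0/=; lra.
    have a2 : `|1 - m (2 * s)| <= e / 12 by apply: hd1; apply/andP; split; lra.
    lra.
  have h2 : x ^+ l.*2.+2 <= 2 * s.
    rewrite exprS; apply: (@le_trans _ _ (x * 1)); last by lra.
    by rewrite ler_pM2l// exprn_ile1// ltW.
  apply: (le_trans (ler_pM (exprn_ge0 _ (ltW x0)) (normr_ge0 _) h2 h1)).
  by rewrite le_eqVlt; apply/orP; left; apply/eqP; field.
by exists x; split; [rewrite x0/=; lra|lra].
Qed.

Lemma regular_normalized : normalized_solution q l.*2.+1 m.
Proof.
split; [exact: dens_integrable| |exact: m_cvg1].
by move=> r r0; rewrite -u_integral//; exact: m_is_derive.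
Qed.

End Regular.

End Solutions.

(** * Orthogonality from equal phase shifts *)

Section Wronskian.
Variable R : realType.
Notation mu := (@lebesgue_measure R).
Implicit Types (q f g u v phi m : R -> R).

(** * The Wronskian of two regular solutions *)

Section Pair.
Variables (q1 q2 : R -> R) (l : nat) (phi1 phi2 : R -> R).
Hypothesis iq1 : forall b : R, 0 < b ->
  mu.-integrable `]0, b] (EFin \o (fun t => t ^+ 2 * q1 t)).
Hypothesis iq2 : forall b : R, 0 < b ->
  mu.-integrable `]0, b] (EFin \o (fun t => t ^+ 2 * q2 t)).
Hypothesis reg1 : regular_solution q1 l phi1.
Hypothesis reg2 : regular_solution q2 l phi2.

Let c : R := (odd_dfact l)%:R.
Let m1 r := c * phi1 r / r ^+ l.+1.
Let m2 r := c * phi2 r / r ^+ l.+1.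
Let u1 r := c * (r ^+ l.+1 * derive1 phi1 r - l.+1%:R * r ^+ l * phi1 r).
Let u2 r := c * (r ^+ l.+1 * derive1 phi2 r - l.+1%:R * r ^+ l * phi2 r).
Let W r := phi1 r * derive1 phi2 r - derive1 phi1 r * phi2 r.

Let WE (r : R) : 0 < r -> c ^+ 2 * W r = m1 r * u2 r - u1 r * m2 r.
Proof.
move=> r0; rewrite /W /m1 /m2 /u1 /u2.
have rl : r ^+ l != 0 by rewrite gt_eqF// exprn_gt0.
have rn : r != 0 by rewrite gt_eqF.
rewrite !exprS; move: (l.+1%:R) (r ^+ l) rl => n p p0.
by field; rewrite rn p0.
Qed.

Let wd (t : R) := t ^+ l.*2.+2 * ((q2 t - q1 t) * (m1 t * m2 t)).

Lemma regular_ac q phi :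
  (forall b : R, 0 < b -> mu.-integrable `]0, b] (EFin \o (fun t => t ^+ 2 * q t))) ->
  regular_solution q l phi ->
  ac_derivative (fun r => c * phi r / r ^+ l.+1)
   (fun r => r ^- l.*2.+2 * (c * (r ^+ l.+1 * derive1 phi r - l.+1%:R * r ^+ l * phi r))).
Proof.
move=> iq reg; apply: ac_C1 => x x0; first exact: (m_is_derive reg).
have cu := ac_continuous (u_ac iq reg) x0.
apply: cvgM; last exact: cu.
by apply: cvgV; [rewrite gt_eqF// exprn_gt0|exact: exprn_continuous].
Qed.

Let wronskian_ac : ac_derivative (fun r => m1 r * u2 r - u1 r * m2 r) wd.
Proof.
have := ac_sub (ac_mul (regular_ac iq1 reg1) (u_ac iq2 reg2))
               (ac_mul (u_ac iq1 reg1) (regular_ac iq2 reg2)).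
rewrite -/c; set f := (X in ac_derivative _ X -> _).
suff -> : f = wd by [].
by apply/funext => r; rewrite /f /wd /m1 /m2; ring.
Qed.

Lemma wronskian_integrable (b : R) : 0 < b -> mu.-integrable `]0, b] (EFin \o wd).
Proof.
move=> b0.
have [_ _ l1] := regular_normalized iq1 reg1.
have [K1 hK1] := cvg1_bounded b0 (m_continuous reg1) l1.
have -> : wd = (fun t => m1 t * (t ^+ l.*2.+2 * ((q2 t - 1) * m2 t)) -
     (t ^+ l.*2.+2 * ((q1 t - 1) * m1 t)) * m2 t).
  by apply/funext => t; rewrite /wd; ring.
have [_ _ l2] := regular_normalized iq2 reg2.
have [K2 hK2] := cvg1_bounded b0 (m_continuous reg2) l2.
apply: integrable_subr => //.
  apply: (@integrableMl_le _ _ _ _ K1) => //.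
  - exact: (measurable_continuous_pos (m_continuous reg1)).
  - exact: (dens_integrable iq2 reg2).
rewrite (_ : (fun t => _) = (fun t => m2 t * (t ^+ l.*2.+2 * ((q1 t - 1) * m1 t)))); last first.
  by apply/funext => t; rewrite mulrC.
apply: (@integrableMl_le _ _ _ _ K2) => //.
- exact: (measurable_continuous_pos (m_continuous reg2)).
- exact: (dens_integrable iq1 reg1).
Qed.

Lemma u_vanishing q phi (e : R) :
  (forall b : R, 0 < b -> mu.-integrable `]0, b] (EFin \o (fun t => t ^+ 2 * q t))) ->
  regular_solution q l phi -> 0 < e ->
  exists d : R, 0 < d /\ forall s, 0 < s <= d ->
   `|c * (s ^+ l.+1 * derive1 phi s - l.+1%:R * s ^+ l * phi s)| <= e.
Proof.
move=> iq reg e0.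
have [d [d0 _ hd]] := Rintegral_oc_cvg0 ltr01 e0 (dens_integrable iq reg ltr01).
exists d; split => // s s0; rewrite /c (u_integral iq reg); first exact: hd.
by case/andP: s0.
Qed.

Lemma wronskian_integral (b : R) : 0 < b ->
  c ^+ 2 * W b = \int[mu]_(t in `]0, b]) wd t.
Proof.
move=> b0; rewrite WE//.
apply: (ac_vanishing b0 wronskian_ac (wronskian_integrable b0)) => e d e0 d0.
have [_ _ l1] := regular_normalized iq1 reg1.
have [_ _ l2] := regular_normalized iq2 reg2.
have [K1 hK1] := cvg1_bounded ltr01 (m_continuous reg1) l1.
have [K2 hK2] := cvg1_bounded ltr01 (m_continuous reg2) l2.
pose K := Num.max 1 (`|K1| + `|K2|).
have K1p : 1 <= K by rewrite le_max lexx.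
have K0 : 0 < K by exact: lt_le_trans K1p.
have eK : 0 < e / (2 * K) by rewrite divr_gt0// mulr_gt0.
have [d1 [d10 h1]] := u_vanishing iq1 reg1 eK.
have [d2 [d20 h2]] := u_vanishing iq2 reg2 eK.
pose s := Num.min (Num.min d d1) (Num.min d2 1) / 2.
have s20 : 0 < Num.min (Num.min d d1) (Num.min d2 1) by rewrite !lt_min d0 d10 d20 ltr01.
have [sd sd1 sd2 s1] : [/\ 2 * s <= d, 2 * s <= d1, 2 * s <= d2 & 2 * s <= 1].
  have -> : 2 * s = Num.min (Num.min d d1) (Num.min d2 1) by rewrite /s; field.
  by rewrite !ge_min !lexx ?orbT.
have s0 : 0 < s by rewrite divr_gt0.
exists s; split; first by rewrite s0/=; lra.
have ms1 : `|m1 s| <= K.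
  apply: (@le_trans _ _ K1); first by apply: hK1; rewrite s0/=; lra.
  by rewrite le_max; apply/orP; right; rewrite (le_trans (ler_norm _))// lerDl.
have ms2 : `|m2 s| <= K.
  apply: (@le_trans _ _ K2); first by apply: hK2; rewrite s0/=; lra.
  by rewrite le_max; apply/orP; right; rewrite (le_trans (ler_norm _))// lerDr.
have us1 : `|u1 s| <= e / (2 * K) by apply: h1; rewrite s0/=; lra.
have us2 : `|u2 s| <= e / (2 * K) by apply: h2; rewrite s0/=; lra.
apply: (le_trans (ler_normB _ _)).
rewrite (normrM (m1 s) (u2 s)) (normrM (u1 s) (m2 s)).
apply: (@le_trans _ _ (K * (e / (2 * K)) + (e / (2 * K)) * K)).
  apply: lerD; apply: ler_pM; try exact: normr_ge0.
  - exact: ms1.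
  - exact: us2.
  - exact: us1.
  - exact: ms2.
by rewrite le_eqVlt; apply/orP; left; apply/eqP; field; rewrite gt_eqF.
Qed.

End Pair.

(** The second derivative is arranged as a continuous factor times an expression in [r^2 q], the
    function whose integrability is available. *)
Lemma ode_ac q l phi :
  (forall b : R, 0 < b -> mu.-integrable `]0, b] (EFin \o (fun t => t ^+ 2 * q t))) ->
  regular_solution q l phi ->
  ac_derivative (derive1 phi) (fun r => phi r / r ^+ 2 * ((l * l.+1)%:R + (r ^+ 2 * q r - r ^+ 2))).
Proof.
move=> iq [[dphi [phi2 h ode]] _].
apply: (ac_ae h).
  move=> s t s0 st; apply: integrable_mul_continuous.
    apply: continuous_in_subspaceT => x; rewrite inE/= in_itv/= => /andP[sx _].
    have x0 : 0 < x by exact: lt_le_trans sx.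
    apply: cvgM.
      by apply: differentiable_continuous; apply/derivable1_diffP; exact: dphi.
    by apply: cvgV; [rewrite gt_eqF// exprn_gt0|exact: exprn_continuous].
  have cint (f : R -> R) : continuous f -> mu.-integrable `[s, t] (EFin \o f).
    move=> cf; apply: continuous_compact_integrable; first exact: segment_compact.
    exact: continuous_subspaceT.
  apply: integrable_addr => //; first by apply: cint => x; exact: cvg_cst.
  apply: integrable_subr => //; last by apply: cint => x; exact: exprn_continuous.
  apply: (integrableS _ _ _ (iq _ (lt_le_trans s0 st))) => //.
  by move=> x; rewrite /= !in_itv/= => /andP[sx ->]; rewrite (lt_le_trans s0).
case: ode => N [mN N0 sub]; exists N; split => // x /= hx; apply: sub => /= e.
apply: hx => x0; have := e x0.
have xn : x != 0 by rewrite gt_eqF.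
move: (_%:R) (phi x) (q x) (phi2 x) => A B C D E.
have -> : D = A / x ^+ 2 * B + C * B - B by lra.
by field.
Qed.

(* At the mean value points of [g] its derivative is small, while [f'] stays
   bounded since [f] and its second derivative are. *)
Lemma wronskian_small (a B C : R) (f g f' g' h : R -> R) :
  0 < a -> 0 <= B -> 0 <= C ->
  (forall r : R, 0 < r -> is_derive r 1 f (f' r)) ->
  (forall r : R, 0 < r -> is_derive r 1 g (g' r)) ->
  ac_derivative f' h ->
  (forall r : R, a < r -> `|h r| <= C * `|f r|) ->
  (forall r : R, a < r -> `|f r| <= B) ->
  (forall e : R, 0 < e -> exists X : R, forall r, X < r -> `|g r| <= e) ->
  forall e X : R, 0 < e -> exists x : R, X < x /\ `|f x * g' x - f' x * g x| <= e.
Proof.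
move=> a0 B0 C0 df dg ac_f' hC fB g0 e X e0.
(* The final bound is [2 e' B + (2 + C) B e' = (4 + C) B e']; [B + 1] keeps the divisor positive. *)
have D0 : 0 < (4 + C) * (B + 1) by rewrite mulr_gt0//; lra.
pose e' := e / ((4 + C) * (B + 1)).
have e'0 : 0 < e' by rewrite divr_gt0.
have [Y gY] := g0 _ e'0.
pose x := `|X| + `|Y| + a + 1.
have [xX xY xa] : [/\ X < x, Y < x & a < x].
  have := ler_norm X; have := ler_norm Y.
  by have := normr_ge0 X; have := normr_ge0 Y; rewrite /x; split; lra.
have x0 : 0 < x by exact: lt_trans xa.
have xx1 : x < x + 1 by rewrite ltrDl.
have mvt (k k' : R -> R) : (forall r : R, 0 < r -> is_derive r 1 k (k' r)) ->
    exists2 z, x < z < x + 1 & k (x + 1) - k x = k' z.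
  move=> dk; have [] := @MVT _ k k' x (x + 1) xx1.
  - by move=> r; rewrite in_itv/= => /andP[xr _]; apply: dk; exact: lt_trans xr.
  - apply: derivable_within_continuous => r; rewrite in_itv/= => /andP[xr _].
    by have [] := dk r (lt_le_trans x0 xr).
  by move=> z; rewrite in_itv/= => zx ->; exists z => //; ring.
have [y xy gy] := mvt _ _ dg.
have [z xz fz] := mvt _ _ df.
have g'y : `|g' y| <= 2 * e'.
  rewrite -gy; apply: (le_trans (ler_normB _ _)).
  have : `|g (x + 1)| <= e' by apply: gY; lra.
  have : `|g x| <= e' by exact: gY.
  lra.
have f'z : `|f' z| <= 2 * B.
  rewrite -fz; apply: (le_trans (ler_normB _ _)).
  have : `|f (x + 1)| <= B by apply: fB; lra.
  have : `|f x| <= B by exact: fB.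
  lra.
have lip s t : x < s -> s <= t -> t < x + 1 -> `|f' t - f' s| <= C * B.
  move=> xs st tx; have [hi ->] := ac_f' _ _ (lt_trans x0 xs) st.
  apply: (le_trans (le_normr_Rintegral _ hi)) => //.
  have ci : mu.-integrable `[s, t] (EFin \o (fun=> C * B)).
    apply: continuous_compact_integrable; first exact: segment_compact.
    by apply: continuous_subspaceT => r; exact: cvg_cst.
  have CB0 : 0 <= C * B by rewrite mulr_ge0.
  apply: (@le_trans _ _ (\int[mu]_(r in `[s, t]) (C * B))).
    apply: le_Rintegral => //; first exact: integrable_normr.
    move=> r; rewrite /= in_itv/= => /andP[sr _].
    have ar : a < r by lra.
    by apply: (le_trans (hC _ ar)); rewrite ler_wpM2l// fB.
  rewrite Rintegral_cst//= lebesgue_measure_itv/= lte_fin.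
  case: ltP => _; last by rewrite mulr0.
  by rewrite -EFinD/=; apply: ler_piMr => //; lra.
have f'y : `|f' y| <= (2 + C) * B.
  have : `|f' y - f' z| <= C * B.
    move: xy xz => /andP[? ?] /andP[? ?].
    by have [yz|zy] := leP y z; [rewrite distrC|]; apply: lip => //; exact: ltW.
  move=> h1; have -> : f' y = (f' y - f' z) + f' z by ring.
  by apply: (le_trans (ler_normD _ _)); lra.
case/andP: xy => xy yx; exists y; split; first exact: lt_trans xy.
apply: (le_trans (ler_normB _ _)); rewrite !normrM.
have fy : `|f y| <= B by apply: fB; exact: lt_trans xy.
have gy' : `|g y| <= e' by apply: gY; exact: lt_trans xy.
apply: (@le_trans _ _ (B * (2 * e') + ((2 + C) * B) * e')).
  by apply: lerD; apply: ler_pM.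
have -> : e = (4 + C) * (B + 1) * e' by rewrite /e' mulrC divfK// gt_eqF.
rewrite -subr_ge0.
have -> : (4 + C) * (B + 1) * e' - (B * (2 * e') + (2 + C) * B * e') = (4 + C) * e' by ring.
by rewrite mulr_ge0// ?ltW//; lra.
Qed.

Lemma sin_add_int_pi (n : int) : exists sg : R, `|sg| = 1 /\
  forall x : R, sin (x + n%:~R * pi) = sg * sin x.
Proof.
have H (k : nat) : exists sg : R, `|sg| = 1 /\ forall x : R, sin (x + k%:R * pi) = sg * sin x.
  elim: k => [|k [sg [sg1 h]]].
    by exists 1; split => [|x]; rewrite ?normr1// mul0r addr0 mul1r.
  exists (- sg); split => [|x]; first by rewrite normrN.
  by rewrite -natr1 mulrDl mul1r addrA sinDpi h mulNr.
case: n => k; first exact: H.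
have [sg [sg1 h]] := H k.+1; exists sg; split => // x.
have sg2 : sg * sg = 1 by rewrite -expr2 -real_normK ?num_real// sg1 expr1n.
rewrite NegzE mulrNz mulNr.
by rewrite -[in RHS](subrK (k.+1%:R * pi) x) h mulrA sg2 mul1r.
Qed.

Lemma phase_shift_orthogonal (a : R) (q1 q2 : R -> R) (l : nat) (delta1 delta2 : R) :
  0 < a ->
  (forall b : R, 0 < b -> mu.-integrable `]0, b] (EFin \o (fun t => t ^+ 2 * q1 t))) ->
  (forall b : R, 0 < b -> mu.-integrable `]0, b] (EFin \o (fun t => t ^+ 2 * q2 t))) ->
  (forall r, a < r -> q1 r = 0) -> (forall r, a < r -> q2 r = 0) ->
  is_phase_shift q1 l delta1 -> is_phase_shift q2 l delta2 -> eq_mod_pi delta1 delta2 ->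
  exists m1 m2, [/\ normalized_solution q1 l.*2.+1 m1, normalized_solution q2 l.*2.+1 m2,
    forall b : R, 0 < b -> mu.-integrable `]0, b]
      (EFin \o (fun t => t ^+ l.*2.+2 * ((q2 t - q1 t) * (m1 t * m2 t)))) &
    forall b : R, a < b -> \int[mu]_(t in `]0, b])
      (t ^+ l.*2.+2 * ((q2 t - q1 t) * (m1 t * m2 t))) = 0].
Proof.
move=> a0 iq1 iq2 q10 q20 [phi1 reg1 [F1 F10 lim1]] [phi2 reg2 [F2 F20 lim2]] [n dn].
exists (fun r => (odd_dfact l)%:R * phi1 r / r ^+ l.+1).
exists (fun r => (odd_dfact l)%:R * phi2 r / r ^+ l.+1).
split.
- exact: regular_normalized.
- exact: regular_normalized.
- by move=> b b0; exact: wronskian_integrable iq1 iq2 reg1 reg2 _ b0.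
move=> b ab; have b0 : 0 < b by exact: lt_trans ab.
have [sg [sg1 hsg]] := sin_add_int_pi n.
pose W r := phi1 r * derive1 phi2 r - derive1 phi1 r * phi2 r.
have W_const x : b <= x -> W x = W b.
  move=> bx; have x0 : 0 < x by exact: lt_le_trans bx.
  have c0 : (odd_dfact l)%:R ^+ 2 != 0 :> R by rewrite gt_eqF// exprn_gt0// odd_dfact_gt0.
  apply: (mulfI c0); apply/eqP; rewrite -subr_eq0.
  rewrite (wronskian_integral iq1 iq2 reg1 reg2 x0) (wronskian_integral iq1 iq2 reg1 reg2 b0).
  rewrite (@Rintegral_itvB _ _ (BRight 0) (BRight x) b) ?bnd_simp ?(ltW b0)//; last first.
    exact: wronskian_integrable iq1 iq2 reg1 reg2 _ x0.
  rewrite (@eq_Rintegral _ _ _ _ _ (fun=> 0)); first by rewrite Rintegral_cst// mul0r.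
  move=> t; rewrite inE/= in_itv/= => /andP[bt _].
  by rewrite q10 ?q20 ?subrr ?mul0r ?mulr0//; exact: lt_trans bt.
rewrite -(wronskian_integral iq1 iq2 reg1 reg2 b0) -/(W b).
suff -> : W b = 0 by rewrite mulr0.
have bnd phi F delta : 0 < F ->
  (phi r - F * sin (r - l%:R * pi / 2%:R + delta)) @[r --> +oo%R] --> (0 : R) ->
  forall e : R, 0 < e -> exists X : R, forall r, X < r ->
    `|phi r - F * sin (r - l%:R * pi / 2%:R + delta)| <= e.
  move=> F0 lim e e0; move/cvgrPdist_le : lim => /(_ e e0) [X [Xr hX]].
  by exists X => r /hX /=; rewrite sub0r normrN.
have [X1 hX1] := bnd _ _ _ F10 lim1 1 ltr01.
(* Beyond [a'] the potential vanishes and [phi1] is within 1 of its sinusoid, hence bounded by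
   [F1 + 1]. *)
pose a' := `|X1| + a.
have a'0 : 0 < a' by rewrite ltr_wpDl.
have aa' : a <= a' by rewrite lerDr.
have X1a' : X1 <= a' by have := ler_norm X1; rewrite /a'; lra.
(* The combination in which the leading sinusoids cancel, so that [g] tends to 0; its Wronskian with
   [phi1] is a nonzero multiple of [W]. *)
pose g r := F1 * sg * phi2 r - F2 * phi1 r.
pose g' r := F1 * sg * derive1 phi2 r - F2 * derive1 phi1 r.
have WE r : phi1 r * g' r - derive1 phi1 r * g r = F1 * sg * W r by rewrite /g /g' /W; ring.
have C0 : 0 <= (l * l.+1)%:R / a ^+ 2 + 1 :> R by rewrite addr_ge0// divr_ge0// exprn_ge0// ltW.
have B0 : 0 <= F1 + 1 by rewrite addr_ge0// ltW.
have dphi1 := phi_is_derive reg1; have dphi2 := phi_is_derive reg2.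
have dg (r : R) : 0 < r -> is_derive r 1 g (g' r).
  move=> r0; have d1 := dphi1 r r0; have d2 := dphi2 r r0.
  by apply: (@is_deriveB _ _ _ ((F1 * sg) \*: phi2) (F2 \*: phi1)).
have small := wronskian_small a'0 B0 C0 dphi1 dg (ode_ac iq1 reg1).
have {}small : forall e X : R, 0 < e ->
  exists x : R, X < x /\ `|phi1 x * g' x - derive1 phi1 x * g x| <= e.
  apply: small.
  - move=> r ar; have r0 : 0 < r by exact: lt_trans ar.
    rewrite q10 ?(le_lt_trans aa')// mulr0 sub0r.
    have -> : phi1 r / r ^+ 2 * ((l * l.+1)%:R - r ^+ 2) =
       ((l * l.+1)%:R / r ^+ 2 - 1) * phi1 r by field; rewrite gt_eqF.
    rewrite normrM ler_wpM2r//; apply: (le_trans (ler_normB _ _)); rewrite normr1 lerD2r.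
    rewrite ger0_norm ?divr_ge0 ?exprn_ge0 ?(ltW r0)//.
    rewrite ler_wpM2l// lef_pV2 ?posrE ?exprn_gt0// lerXn2r ?nnegrE ?(ltW a0) ?(ltW r0)//.
    exact/ltW/(le_lt_trans aa').
  - move=> r ar; have := hX1 r (le_lt_trans X1a' ar).
    set sn := sin _ => h.
    have -> : phi1 r = (phi1 r - F1 * sn) + F1 * sn by ring.
    apply: (le_trans (ler_normD _ _)); rewrite addrC lerD//.
    by rewrite normrM (gtr0_norm F10) ger_pMr// ler_norml sin_geN1 sin_le1.
  - move=> e e0.
    have e1 : 0 < e / (2 * F1) by rewrite divr_gt0// mulr_gt0.
    have e2 : 0 < e / (2 * F2) by rewrite divr_gt0// mulr_gt0.
    have [Y1 hY1] := bnd _ _ _ F10 lim1 _ e2.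
    have [Y2 hY2] := bnd _ _ _ F20 lim2 _ e1.
    exists (Num.max Y1 Y2) => r; rewrite gt_max => /andP[/hY1 k1 /hY2 k2].
    move: k1 k2; set x := r - _ + delta2.
    rewrite dn addrA hsg -/x /g => k1 k2.
    have -> : F1 * sg * phi2 r - F2 * phi1 r =
      F1 * sg * (phi2 r - F2 * sin x) - F2 * (phi1 r - F1 * (sg * sin x)) by ring.
    apply: (le_trans (ler_normB _ _)).
    rewrite !normrM sg1 mulr1 (gtr0_norm F10) (gtr0_norm F20).
    have -> : e = F1 * (e / (2 * F1)) + F2 * (e / (2 * F2)) by field; rewrite !gt_eqF.
    by rewrite lerD// ler_pM2l.
apply/eqP; rewrite -normr_le0; apply/ler_addgt0Pr => e e0; rewrite add0r.
have [x [bx]] := small (F1 * e) b (mulr_gt0 F10 e0).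
rewrite WE (W_const _ (ltW bx)) !normrM sg1 mulr1 (gtr0_norm F10).
by rewrite ler_pM2l.
Qed.

End Wronskian.

(** * Integrability of radial potentials *)

Section Potential.
Variable R : realType.
Notation mu := (@lebesgue_measure R).
Notation RR := (measurableTypeR R).
Implicit Types q : R -> R.

(** Values of [q] at negative arguments do not affect the potential on R^3, so measurability is
    obtained for [q |r|], the restriction of the potential to a coordinate axis. *)
Lemma potential_radial (a : R) q : 0 < a -> potential_class a (spherical q) ->
  (forall r, a < r -> q r = 0) /\
  exists p : R, [/\ 3 / 2 < p,
    measurable_fun setT ((fun r : R => q `|r|) : RR -> RR) &
    mu.-integrable `]0, +oo[ (EFin \o (fun r => r ^+ 2 * `|q r| `^ p))].
Proof.
move=> a0 [q0 [p p32 Lq]].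
have enorm0 (r : R) : enorm3 (0, 0, r) = `|r|.
  by rewrite /enorm3/= !expr0n/= !add0r sqrtr_sqr.
have qa r : a < r -> q r = 0.
  move=> ar; have := q0 (0, 0, r); rewrite /spherical enorm0.
  by rewrite gtr0_norm ?(lt_trans a0)//; apply.
split => //; exists p.
have E : patch (fun=> point) (@cball3 R a) (spherical q) = spherical q.
  apply/funext => x; rewrite /patch; case: ifPn => // /negP.
  by rewrite inE /cball3/= => /negP; rewrite -ltNge => /q0 ->.
rewrite E in Lq.
have p1 : 1 <= p by apply: ltW; apply: lt_trans p32; rewrite ltr_pdivlMr//; lra.
have ms : measurable_fun setT (spherical q : RR * RR * RR -> RR).
  by have := sub_Lfun_mfun Lq; rewrite inE.
have mq : measurable_fun setT ((fun r : R => q `|r|) : RR -> RR).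
  have -> : (fun r : R => q `|r|) = spherical q \o (fun r => (0, 0, r)).
    by apply/funext => r /=; rewrite /spherical enorm0.
  apply: (measurableT_comp ms).
  exact: (pair1_measurable ((0, 0) : RR * RR)).
split => //.
have iq := Lfun_integrable p1 Lq.
pose G (r : RR) := (`|q `|r| | `^ p)%:E.
have mG : measurable_fun setT G.
  apply/measurable_EFinP; apply: (measurableT_comp (measurable_powR _)) => //.
  exact: measurableT_comp.
have G0 r : (0 <= G r)%E by rewrite lee_fin powR_ge0.
have H := @ge0_integral_radial R G mG G0.
have fin3 : (\int[@lebesgue_measure3 R]_x G (enorm3 x) < +oo)%E.
  have /integrableP[_] := iq; apply: le_lt_trans.
  rewrite le_eqVlt; apply/orP; left; apply/eqP; apply: eq_integral => x _.
  have e0 : 0 <= enorm3 x by exact: sqrtr_ge0.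
  by rewrite gee0_abs ?lee_fin ?powR_ge0// /G /spherical (ger0_norm e0).
have mw : measurable_fun (`]0%R, +oo[%classic : set R)
    ((fun r : R => r ^+ 2 * `|q r| `^ p) : RR -> RR).
  apply: (@eq_measurable_fun _ _ RR RR _ (fun r : RR => r ^+ 2 * `|q `|r| | `^ p)).
    by move=> r; rewrite inE/= in_itv/= andbT => r0; rewrite (gtr0_norm r0).
  apply: measurable_funTS; apply: measurable_funM; first exact: measurable_funX.
  apply: (measurableT_comp (measurable_powR _)) => //.
  exact: measurableT_comp.
apply/integrableP; split; first exact/measurable_EFinP.
(* The factor 4 undoes the halving in [(r / 2)^2]. *)
apply: (@le_lt_trans _ _ (4%:E *
    \int[mu]_(r in `]0%R, +oo[) (((r / 2) ^+ 2)%:E * G r))%E); last first.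
  rewrite lte_mul_pinfty//; apply: (le_lt_trans H).
  by rewrite lte_mul_pinfty.
rewrite -ge0_integralZl//.
- rewrite le_eqVlt; apply/orP; left; apply/eqP; apply: eq_integral => r.
  rewrite inE/= in_itv/= andbT => r0.
  rewrite /G (gtr0_norm r0) -!EFinM ger0_norm ?mulr_ge0 ?powR_ge0 ?ltW//.
  by congr EFin; move: (_ `^ p) => A; field.
- apply: emeasurable_funM; last exact: measurable_funTS.
  apply/measurable_EFinP; apply: measurable_funTS; apply: measurable_funX.
  exact: measurable_funM.
- by move=> r _; rewrite mule_ge0// lee_fin sqr_ge0.
Qed.

Lemma Rintegral_expr (M : nat) (r : R) : 0 < r ->
  \int[mu]_(t in `]0, r]) t ^+ M = r ^+ M.+1 / M.+1%:R.
Proof.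
move=> r0; have ei : mu.-integrable `]0, r] (EFin \o (fun t => M.+1%:R * t ^+ M)).
  apply: (@integrableS _ _ _ mu `[0, r]) => //; first exact: subset_itv_oc_cc.
  apply: continuous_compact_integrable; first exact: segment_compact.
  by apply: continuous_subspaceT => x; exact: continuous_expr.
have -> : r ^+ M.+1 = \int[mu]_(t in `]0, r]) (M.+1%:R * t ^+ M).
  have := @ac_vanishing R (fun t => t ^+ M.+1) _ r r0 (@ac_expr R M.+1) ei.
  apply => e d e0 d0.
  pose s := Num.min (Num.min d e) 1 / 2.
  have s20 : 0 < Num.min (Num.min d e) 1 by rewrite !lt_min d0 e0 ltr01.
  have [sd se s1] : [/\ 2 * s <= d, 2 * s <= e & 2 * s <= 1].
    have -> : 2 * s = Num.min (Num.min d e) 1 by rewrite /s; field.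
    by rewrite !ge_min !lexx ?orbT.
  have s0 : 0 < s by rewrite divr_gt0.
  exists s; split; first by rewrite s0/=; lra.
  rewrite ger0_norm ?exprn_ge0 ?(ltW s0)// exprS.
  apply: (@le_trans _ _ (s * 1)); last by lra.
  by rewrite ler_pM2l// exprn_ile1//; lra.
rewrite RintegralZl//; first by rewrite mulrAC divff ?mul1r// pnatr_eq0.
rewrite (_ : (fun t => t ^+ M) = (fun t => M.+1%:R^-1 * (M.+1%:R * t ^+ M))); last first.
  by apply/funext => t; rewrite mulrA mulVf ?mul1r// pnatr_eq0.
exact: integrable_scaler.
Qed.

(* The factor [r^be] makes the bound, divided by [r^(M+2)], integrable at 0. *)
Definition scaled_estimate q (b : R) := exists2 be : R, 0 < be &
  forall eta : R, 0 < eta -> exists M0 : nat, forall M : nat, (M0 <= M)%N ->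
  forall r : R, 0 < r <= b ->
  \int[mu]_(t in `]0, r]) (t ^+ 2 * `|q t - 1| * t ^+ M) <= eta * r `^ be * r ^+ M.+1.

Section Estimate.
Variables (q : R -> R) (p : R).
Hypothesis p32 : 3 / 2 < p.
Hypothesis mq : measurable_fun setT ((fun r : R => q `|r|) : RR -> RR).
Hypothesis iw : mu.-integrable `]0, +oo[ (EFin \o (fun r => r ^+ 2 * `|q r| `^ p)).

Let w r := r ^+ 2 * `|q r| `^ p.
(** Positive exactly when [p > 3/2]. It is the exponent of [t^2 t^(-3/p)], where [t^(-3/p)] is the
    borderline power for the integrability of [t^2 |q|^p] at 0. *)
Let be : R := 2 - 3 / p.

Let p0 : 0 < p. Proof. by apply: lt_trans p32; rewrite divr_gt0. Qed.

Let p1 : 0 < p - 1.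
Proof. by rewrite subr_gt0; apply: lt_trans p32; rewrite ltr_pdivlMr//; lra. Qed.

Let be0 : 0 < be.
Proof.
rewrite subr_gt0 ltr_pdivrMr//.
by move: p32; rewrite ltr_pdivrMr// mulrC.
Qed.

Let be2 : 0 <= 2 - be.
Proof. by rewrite /be opprB addrC subrK divr_ge0// ltW. Qed.

(* Young's inequality, by comparing [`|q t|] with [c^(1/(p-1)) t^(-3/p)]. *)
Lemma radial_young (c t : R) : 0 < c -> 0 < t ->
  t ^+ 2 * `|q t| <= c `^ (p - 1)^-1 * t `^ be + c^-1 * (t `^ be * t) * w t.
Proof.
move=> c0 t0; set K : R := c `^ _; set A := `|q t|.
have K0 : 0 < K by exact: powR_gt0.
have tb0 : 0 < t `^ be by exact: powR_gt0.
have E2 : t ^+ 2 * t `^ (be - 2) = t `^ be.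
  rewrite -powR_mulrn ?(ltW t0)// -powRD; last by rewrite (gt_eqF t0) implybT.
  by congr (_ `^ _); ring.
have [Ac|cA] := leP A (K * t `^ (be - 2)).
  apply: (@le_trans _ _ (K * t `^ be)).
    by rewrite -E2 mulrCA ler_wpM2l// sqr_ge0.
  rewrite lerDl /w mulr_ge0 ?mulr_ge0 ?invr_ge0 ?powR_ge0 ?sqr_ge0//; exact: ltW.
have A0 : 0 < A by apply: lt_trans cA; rewrite mulr_gt0// powR_gt0.
suff H : A * (c * (t `^ be * t)^-1) <= A `^ p.
  apply: (@le_trans _ _ (c^-1 * (t `^ be * t) * w t)); last by rewrite lerDr mulr_ge0// ltW.
  rewrite /w -/A mulrCA ler_pM2l ?exprn_gt0//.
  rewrite [X in X <= _](_ : A = c^-1 * (t `^ be * t) * (A * (c * (t `^ be * t)^-1))); last first.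
    by field; rewrite !gt_eqF.
  by rewrite ler_pM2l// mulr_gt0 ?invr_gt0// mulr_gt0.
have -> : A `^ p = A * A `^ (p - 1).
  rewrite -[X in X * _]powRr1 ?(ltW A0)// -powRD; last by rewrite (gt_eqF A0) implybT.
  by congr (_ `^ _); ring.
rewrite ler_pM2l//.
have -> : c * (t `^ be * t)^-1 = (K * t `^ (be - 2)) `^ (p - 1).
  rewrite powRM ?powR_ge0 ?(ltW K0)// /K -!powRrM mulVf ?gt_eqF// powRr1 ?(ltW c0)//.
  congr (_ * _); rewrite -[X in _ * X]powRr1 ?(ltW t0)// -powRD; last first.
    by rewrite (gt_eqF t0) implybT.
  by rewrite -powRN; congr (_ `^ _); rewrite /be; field; rewrite gt_eqF.
by rewrite ge0_ler_powR ?(ltW p1)// ?nnegrE ?mulr_ge0 ?powR_ge0 ?(ltW K0)// ltW.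
Qed.

Let measurable_q (b : R) : measurable_fun `]0, b] (q : RR -> RR).
Proof.
apply: (@eq_measurable_fun _ _ RR RR _ (fun r : RR => q `|r|)).
  by move=> r; rewrite inE/= in_itv/= => /andP[r0 _]; rewrite (gtr0_norm r0).
exact: measurable_funTS.
Qed.

Lemma radial_integrable (b : R) : 0 < b ->
  mu.-integrable `]0, b] (EFin \o (fun t => t ^+ 2 * q t)).
Proof.
move=> b0.
have cst_int (k : R) : mu.-integrable `]0, b] (EFin \o (fun=> k)).
  apply: (@integrableS _ _ _ mu `[0, b]) => //; first exact: subset_itv_oc_cc.
  apply: continuous_compact_integrable; first exact: segment_compact.
  by apply: continuous_subspaceT => x; exact: cvg_cst.
apply: (@integrable_le _ _ _ (fun t => b `^ be + (b `^ be * b) * w t)) => //.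
- apply: measurable_funM; last exact: measurable_q.
  by apply: measurable_funTS; apply: measurable_funX.
- apply: integrable_addr => //; apply: integrable_scaler => //.
  apply: (integrableS _ _ _ iw) => // x; rewrite /= !in_itv/= => /andP[-> _] //.
- move=> t; rewrite /= in_itv/= => /andP[t0 tb].
  have := @radial_young 1 t ltr01 t0.
  rewrite powR1 mul1r invr1 mul1r normrM ger0_norm ?sqr_ge0// => /le_trans; apply.
  have tbe : t `^ be <= b `^ be.
    by rewrite ge0_ler_powR ?nnegrE ?(ltW be0) ?(ltW t0) ?(ltW b0).
  have w0 : 0 <= w t by rewrite mulr_ge0 ?sqr_ge0 ?powR_ge0.
  rewrite lerD// ler_wpM2r// ler_pM ?powR_ge0//; exact: ltW.
Qed.

(** Young's inequality splits the integral: the pure power gains [1 / (M + 1)] from integrating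
    [t^M], the part in [w] gains [1 / c]. So [c] is chosen from [eta] before [M], since the constant
    [K] of the power part depends on [c]. *)
Lemma radial_scaled_estimate (b : R) : 0 < b -> scaled_estimate q b.
Proof.
move=> b0; exists be; first exact: be0.
move=> eta eta0.
pose Wt := \int[mu]_(t in `]0, +oo[) w t.
have w0 t : 0 <= w t by rewrite mulr_ge0 ?sqr_ge0 ?powR_ge0.
have W0 : 0 <= Wt by apply: Rintegral_ge0 => t _; exact: w0.
pose c := 2 * (Wt + 1) / eta.
have c0 : 0 < c by rewrite divr_gt0// mulr_gt0// ltr_wpDl.
(* The second summand pays for the 1 in [q - 1], through [t^2 <= r^be b^(2 - be)]. *)
pose K := c `^ (p - 1)^-1 + b `^ (2 - be).
have K0 : 0 <= K by rewrite addr_ge0 ?powR_ge0.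
exists (Num.truncn (2 * K / eta)) => M MM r /andP[r0 rb].
have KM : K / M.+1%:R <= eta / 2.
  have h : 2 * K / eta <= M.+1%:R.
    apply: (le_trans (ltW (truncnS_gt _))).
    by rewrite ler_nat.
  rewrite ler_pdivrMr ?ltr0n// mulrC mulrA mulrC -ler_pdivrMl//.
  by move: h; rewrite ler_pdivrMr// => h; rewrite ler_pdivrMl//; lra.
have iw0 : mu.-integrable `]0, r] (EFin \o w).
  by apply: (integrableS _ _ _ iw) => // x; rewrite /= !in_itv/= => /andP[-> _].
have Wr : \int[mu]_(t in `]0, r]) w t <= Wt.
  rewrite /Wt /Rintegral fine_le//.
  - by apply: integrable_fin_num.
  - by apply: integrable_fin_num.
  - apply: ge0_subset_integral => //.
    + exact: measurable_int iw.
    + by move=> t _; rewrite lee_fin.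
    + by move=> x; rewrite /= !in_itv/= => /andP[-> _].
have ie : mu.-integrable `]0, r] (EFin \o (fun t => t ^+ M)).
  apply: (@integrableS _ _ _ mu `[0, r]) => //; first exact: subset_itv_oc_cc.
  apply: continuous_compact_integrable; first exact: segment_compact.
  by apply: continuous_subspaceT => x; exact: exprn_continuous.
have rbe0 : 0 < r `^ be by exact: powR_gt0.
have pt t : `]0, r]%classic t -> t ^+ 2 * `|q t - 1| * t ^+ M <=
    r `^ be * K * t ^+ M + r `^ be * (c^-1 * r ^+ M.+1) * w t.
  rewrite /= in_itv/= => /andP[t0 tr].
  have tM : 0 <= t ^+ M by rewrite exprn_ge0// ltW.
  have tbe : t `^ be <= r `^ be.
    by rewrite ge0_ler_powR ?nnegrE ?(ltW be0) ?(ltW t0) ?(ltW r0).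
  have t2 : t ^+ 2 <= r `^ be * b `^ (2 - be).
    have -> : t ^+ 2 = t `^ be * t `^ (2 - be).
      rewrite -powR_mulrn ?(ltW t0)// -powRD; last by rewrite (gt_eqF t0) implybT.
      by congr (_ `^ _); ring.
    rewrite ler_pM ?powR_ge0// ge0_ler_powR ?nnegrE ?be2 ?(ltW t0) ?(ltW b0)//.
    exact: le_trans rb.
  have y := radial_young c0 t0.
  have y1 : t ^+ 2 * `|q t - 1| <= t ^+ 2 * `|q t| + t ^+ 2.
    have -> : t ^+ 2 * `|q t| + t ^+ 2 = t ^+ 2 * (`|q t| + 1) by ring.
    rewrite ler_wpM2l ?sqr_ge0//.
    by apply: (le_trans (ler_normB _ _)); rewrite normr1.
  have y2 : t ^+ 2 * `|q t - 1| <= r `^ be * K + c^-1 * (r `^ be * t) * w t.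
    have z1 : c `^ (p - 1)^-1 * t `^ be <= c `^ (p - 1)^-1 * r `^ be.
      by rewrite ler_wpM2l ?powR_ge0.
    have z2 : c^-1 * (t `^ be * t) * w t <= c^-1 * (r `^ be * t) * w t.
      rewrite ler_wpM2r// ler_wpM2l ?invr_ge0 ?(ltW c0)// ler_wpM2r//; exact: ltW.
    have -> : r `^ be * K = c `^ (p - 1)^-1 * r `^ be + r `^ be * b `^ (2 - be).
      by rewrite /K; ring.
    by move: y y1 z1 z2 t2; lra.
  apply: (@le_trans _ _ ((r `^ be * K + c^-1 * (r `^ be * t) * w t) * t ^+ M)).
    by rewrite ler_wpM2r.
  rewrite mulrDl lerD2l.
  have -> : c^-1 * (r `^ be * t) * w t * t ^+ M = r `^ be * (c^-1 * t ^+ M.+1) * w t.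
    by rewrite exprS; ring.
  rewrite ler_wpM2r// ler_wpM2l ?(ltW rbe0)// ler_wpM2l ?invr_ge0 ?(ltW c0)//.
  by rewrite lerXn2r ?nnegrE ?(ltW t0) ?(ltW r0).
have ib : mu.-integrable `]0, r] (EFin \o (fun t =>
    r `^ be * K * t ^+ M + r `^ be * (c^-1 * r ^+ M.+1) * w t)).
  by apply: integrable_addr => //; exact: integrable_scaler.
apply: (@le_trans _ _ (\int[mu]_(t in `]0, r])
   (r `^ be * K * t ^+ M + r `^ be * (c^-1 * r ^+ M.+1) * w t))).
  apply: le_Rintegral => //.
  apply: (integrable_le _ _ ib) => //.
    apply: measurable_funM; last by apply: measurable_funTS; apply: measurable_funX.
    apply: measurable_funM; first by apply: measurable_funTS; apply: measurable_funX.
    apply: measurableT_comp => //; apply: measurable_funB => //; exact: measurable_q.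
  move=> t rt; rewrite ger0_norm; first exact: pt.
  by move: rt; rewrite /= in_itv/= => /andP[t0 _]; rewrite !mulr_ge0 ?exprn_ge0 ?(ltW t0).
rewrite RintegralD// ?RintegralZl//; [|exact: integrable_scaler|exact: integrable_scaler].
rewrite Rintegral_expr//.
have rM : 0 < r ^+ M.+1 by rewrite exprn_gt0.
have cW : c^-1 * \int[mu]_(t in `]0, r]) w t <= eta / 2.
  apply: (@le_trans _ _ (c^-1 * (Wt + 1))).
    by rewrite ler_wpM2l ?invr_ge0 ?(ltW c0)//; lra.
  rewrite /c le_eqVlt; apply/orP; left; apply/eqP; field.
  by rewrite !gt_eqF// ltr_wpDl.
have -> : r `^ be * K * (r ^+ M.+1 / M.+1%:R) +
  r `^ be * (c^-1 * r ^+ M.+1) * (\int[mu]_(t in `]0, r]) w t) =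
  (r `^ be * r ^+ M.+1) * (K / M.+1%:R + c^-1 * (\int[mu]_(t in `]0, r]) w t)) by ring.
have -> : eta * r `^ be * r ^+ M.+1 = (r `^ be * r ^+ M.+1) * eta by ring.
by rewrite ler_pM2l ?mulr_gt0// [eta]splitr lerD.
Qed.

End Estimate.

End Potential.

(** * Perturbation of polynomials by the solutions *)

Section Perturbation.
Variable R : realType.
Notation mu := (@lebesgue_measure R).
Implicit Types (p : {poly R}).

Lemma Rintegral_sum_ord (D : set R) (n : nat) (f : nat -> R -> R) : measurable D ->
  (forall k, (k < n)%N -> mu.-integrable D (EFin \o f k)) ->
  mu.-integrable D (EFin \o (fun x => \sum_(k < n) f k x)) /\
  \int[mu]_(x in D) (\sum_(k < n) f k x) = \sum_(k < n) \int[mu]_(x in D) f k x.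
Proof.
move=> mD; elim: n => [|n IH] fi.
  have E0 : (fun x => \sum_(k < 0) f k x) = (fun=> 0) by apply/funext => x; rewrite big_ord0.
  rewrite E0 big_ord0 Rintegral_cst// mul0r; split => //.
  by rewrite (_ : _ \o _ = cst 0%E)//; exact: integrable0.
have [i1 e1] := IH (fun k kn => fi k (leqW kn)).
have ES : (fun x => \sum_(k < n.+1) f k x) = (fun x => \sum_(k < n) f k x + f n x).
  by apply/funext => x; rewrite big_ord_recr.
rewrite ES big_ord_recr/= -e1; split; first by apply: integrable_addr => //; exact: fi.
by rewrite RintegralD//; exact: fi.
Qed.

Lemma is_derive_sum_ord (n : nat) (f : nat -> R -> R) (f' : nat -> R) (x : R) :
  (forall k, (k < n)%N -> is_derive x 1 (f k) (f' k)) ->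
  is_derive x 1 (fun x => \sum_(k < n) f k x) (\sum_(k < n) f' k).
Proof.
elim: n => [|n IH] fi.
  rewrite big_ord0 (_ : (fun x => _) = cst 0); first exact: is_derive_cst.
  by apply/funext => y; rewrite big_ord0.
rewrite big_ord_recr/= (_ : (fun x => _) = (fun x => \sum_(k < n) f k x) + f n); last first.
  by apply/funext => y; rewrite big_ord_recr.
by apply: is_deriveD; [apply: IH => k kn; apply: fi; exact: leqW|exact: fi].
Qed.

(* A bound [c r^be / r] on the derivative is integrable at 0. *)
Lemma derive_powR_bound (f f' : R -> R) (f0 be c b : R) : 0 < be -> 0 <= c ->
  (forall r : R, 0 < r <= b -> is_derive r 1 f (f' r)) ->
  (forall r : R, 0 < r <= b -> `|f' r| <= c * r `^ be / r) ->
  f r @[r --> 0^'+] --> f0 ->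
  forall r, 0 < r <= b -> `|f r - f0| <= c / be * r `^ be.
Proof.
move=> be0 c0 df f'b f0l r /andP[r0 rb].
have step s : 0 < s -> s < r -> `|f r - f s| <= c / be * r `^ be.
  move=> s0 sr.
  have pos x : s <= x -> 0 < x by exact: lt_le_trans.
  have dg (x : R) : 0 < x -> is_derive x 1 (fun r : R => c / be * r `^ be) (c * x `^ be / x).
    move=> x0; have dp := is_derive1_powR be x0.
    have E : x `^ (be - 1) = x `^ be / x.
      by rewrite powRB ?(gt_eqF x0)// ?powRr1 ?(ltW x0)// implybT.
    rewrite E in dp.
    have := @is_deriveZ _ _ _ (fun r : R => r `^ be) (c / be) x 1 _ dp.
    have -> : (c / be) *: (be * (x `^ be / x)) = c * x `^ be / x.
      by rewrite /GRing.scale/=; field; rewrite !gt_eqF.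
    by [].
  (* Applied to [(c / be) r^be - f] and [(c / be) r^be + f], whose derivatives are nonnegative by
     the bound on [f']. *)
  have key (g g' : R -> R) : (forall x : R, 0 < x <= b -> is_derive x 1 g (g' x)) ->
      (forall x : R, 0 < x <= b -> 0 <= g' x) -> g s <= g r.
    move=> dgg g'0; have [] := @MVT _ g g' s r sr.
    - move=> x; rewrite in_itv/= => /andP[sx xr]; apply: dgg.
      by rewrite (pos _ (ltW sx)) (le_trans (ltW xr)).
    - apply: derivable_within_continuous => x; rewrite in_itv/= => /andP[sx xr].
      by case: (dgg x _) => //; rewrite (pos _ sx) (le_trans xr).
    move=> x; rewrite in_itv/= => /andP[sx xr] E; rewrite -subr_ge0 E mulr_ge0//.
      by apply: g'0; rewrite (pos _ (ltW sx)) (le_trans (ltW xr)).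
    by rewrite subr_ge0 ltW.
  have sp : 0 <= c / be * s `^ be by rewrite mulr_ge0 ?powR_ge0// divr_ge0// ltW.
  have k1 := key ((fun r : R => c / be * r `^ be) - f) (fun x => c * x `^ be / x - f' x).
  have k2 := key ((fun r : R => c / be * r `^ be) + f) (fun x => c * x `^ be / x + f' x).
  have {}k1 : c / be * s `^ be - f s <= c / be * r `^ be - f r.
    apply: k1 => x /andP[x0 xb].
      by apply: is_deriveB; [exact: dg|apply: df; rewrite x0].
    have := f'b x; rewrite x0 xb => /(_ isT); rewrite ler_norml => /andP[_ h].
    by rewrite subr_ge0.
  have {}k2 : c / be * s `^ be + f s <= c / be * r `^ be + f r.
    apply: k2 => x /andP[x0 xb].
      by apply: is_deriveD; [exact: dg|apply: df; rewrite x0].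
    have := f'b x; rewrite x0 xb => /(_ isT); rewrite ler_norml => /andP[h _].
    by rewrite -lerBlDl sub0r.
  rewrite ler_norml; move: sp k1 k2.
  by move: (_ * s `^ be) (_ * r `^ be) (f s) (f r) => *; lra.
apply/ler_addgt0Pr => e e0.
have /cvgrPdist_le/(_ _ e0) := f0l.
rewrite near_withinE => /nbhs_ballP[d /= d0 hd].
pose s := Num.min d r / 2.
have s20 : 0 < Num.min d r by rewrite lt_min d0 r0.
have [sd sr] : 2 * s <= d /\ 2 * s <= r.
  have -> : 2 * s = Num.min d r by rewrite /s; field.
  by rewrite !ge_min !lexx ?orbT.
have s0 : 0 < s by rewrite divr_gt0.
have h1 : `|f0 - f s| <= e.
  by apply: hd => //; rewrite /ball/= sub0r normrN gtr0_norm//; lra.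
have h2 := step s s0 _.
have -> : f r - f0 = (f r - f s) - (f0 - f s) by ring.
by apply: (le_trans (ler_normB _ _)); rewrite lerD// h2//; lra.
Qed.

(* On the diagonal, [(evol m r p).[r]] is the image of [p] under the
   transformation [x^k |-> x^k m_k(x)]. *)
Definition evol (m : nat -> R -> R) (r : R) p : {poly R} :=
  \poly_(k < size p) (p`_k * m k r).

Lemma coef_evol m r p k : (evol m r p)`_k = p`_k * m k r.
Proof.
by rewrite coef_poly; case: ltnP => // h; rewrite nth_default ?mul0r.
Qed.

Lemma horner_evol m r p y : (evol m r p).[y] = \sum_(k < size p) (p`_k * m k r) * y ^+ k.
Proof. by rewrite horner_poly. Qed.

Section OnePotential.
Variables (q : R -> R) (b : R) (S : nat -> Prop) (m : nat -> R -> R).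
Hypothesis b0 : 0 < b.
Hypothesis est : scaled_estimate q b.
Hypothesis iq : mu.-integrable `]0, b] (EFin \o (fun t => t ^+ 2 * q t)).
Hypothesis sol : forall k, S k -> normalized_solution q k (m k).

Let m_cont k : S k -> forall r : R, 0 < r -> {for r, continuous (m k)}.
Proof.
move=> /sol[_ d _] r /d [h _]; apply: differentiable_continuous.
exact/derivable1_diffP.
Qed.

Let m_bounded k : S k -> exists K, forall r, 0 < r <= b -> `|m k r| <= K.
Proof. by move=> Sk; have [_ _ l] := sol Sk; exact: cvg1_bounded b0 (m_cont Sk) l. Qed.

(** This constant depends on the coefficients of [p]. It only starts the iteration in [evol_close],
    whose conclusion is free of it. *)
Lemma evol_bounded p (N : nat) : supported p (fun k => S k /\ (N <= k)%N) ->
  exists B, 0 <= B /\ forall t z, 0 < t <= b -> 0 < z <= b ->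
    `|(evol m t p).[z]| <= B * z ^+ N.
Proof.
move=> ps.
suff H : forall n, exists B, 0 <= B /\ forall t z, 0 < t <= b -> 0 < z <= b ->
    `|\sum_(k < n) (p`_k * m k t) * z ^+ k| <= B * z ^+ N.
  have [B [B0 hB]] := H (size p).
  by exists B; split => // t z tb zb; rewrite horner_evol; exact: hB.
elim=> [|n [B [B0 hB]]].
  by exists 0; split => // t z _ _; rewrite big_ord0 normr0 mul0r.
have [pn0|pn] := eqVneq p`_n 0.
  exists B; split => // t z tb zb; rewrite big_ord_recr/= pn0 !mul0r addr0; exact: hB.
have [Sn Nn] := ps _ pn; have [K hK] := m_bounded Sn.
have K0 : 0 <= K by apply: (le_trans (normr_ge0 (m n b))); apply: hK; rewrite b0/=.
exists (B + `|p`_n| * K * b ^+ (n - N)); split.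
  by rewrite addr_ge0// !mulr_ge0// exprn_ge0// ltW.
move=> t z tb zb; rewrite big_ord_recr/=; apply: (le_trans (ler_normD _ _)).
rewrite mulrDl lerD//; first exact: hB.
move: (zb) => /andP[z0 zb'].
rewrite !normrM normrX (gtr0_norm z0) -[in z ^+ n](subnK Nn) exprD mulrA.
rewrite ler_wpM2r ?exprn_ge0 ?(ltW z0)//.
rewrite ler_pM ?mulr_ge0// ?exprn_ge0 ?(ltW z0)// ?ler_wpM2l ?hK//.
by rewrite lerXn2r// nnegrE ltW.
Qed.

Lemma evol_cvg p y : supported p S -> (evol m r p).[y] @[r --> 0^'+] --> p.[y].
Proof.
move=> ps; rewrite horner_coef.
rewrite (_ : (fun r => (evol m r p).[y]) =
  (fun r => \sum_(k < size p) (p`_k * m k r) * y ^+ k)); last first.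
  by apply/funext => r; rewrite horner_evol.
elim: (size p) => [|n IH].
  rewrite big_ord0 (_ : (fun r => _) = cst 0); first exact: cvg_cst.
  by apply/funext => r; rewrite big_ord0.
rewrite big_ord_recr/= (_ : (fun r => _) = (fun r => \sum_(k < n) (p`_k * m k r) * y ^+ k +
   (p`_n * m n r) * y ^+ n)); last by apply/funext => r; rewrite big_ord_recr.
apply: cvgD => //.
have [->|pn] := eqVneq p`_n 0.
  rewrite mul0r (_ : (fun r => _) = cst 0); first exact: cvg_cst.
  by apply/funext => r; rewrite !mul0r.
have [_ _ l] := sol (ps _ pn).
apply: cvgM; last exact: cvg_cst.
rewrite -[X in _ --> X]mulr1.
by apply: cvgM; [exact: cvg_cst|exact: l].
Qed.

Let Q t := t ^+ 2 * `|q t - 1|.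

Let Q_integrable r : 0 < r <= b -> mu.-integrable `]0, r] (EFin \o Q).
Proof.
move=> /andP[r0 rb].
rewrite (_ : Q = (fun t => `|t ^+ 2 * q t - t ^+ 2|)); last first.
  apply/funext => t; rewrite /Q -[X in X * _]ger0_norm ?sqr_ge0// -normrM.
  by congr (`| _ |); ring.
apply: integrable_normr => //; apply: integrable_subr => //.
  apply: (integrableS _ _ _ iq) => // x; rewrite /= !in_itv/= => /andP[-> xr].
  by rewrite (le_trans xr).
apply: (@integrableS _ _ _ mu `[0, r]) => //; first exact: subset_itv_oc_cc.
apply: continuous_compact_integrable; first exact: segment_compact.
by apply: continuous_subspaceT => x; exact: exprn_continuous.
Qed.

(** Summed under the integral, the equations of the [m_k] give the integrand
    [(t / r) (q - 1) P(t, y t / r)]. Its second argument stays at most [y], so the hypothesis on [P]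
    applies and leaves [t^2 |q - 1| t^M] times a constant. *)
Lemma evol_derive p (M : nat) (B eta be y : R) : 0 <= B -> 0 < y <= b ->
  supported p (fun k => S k /\ (M < k)%N) ->
  (forall t z, 0 < t <= b -> 0 < z <= b -> `|(evol m t p).[z]| <= B * z ^+ M.+1) ->
  (forall r : R, 0 < r <= b ->
    \int[mu]_(t in `]0, r]) (Q t * t ^+ M) <= eta * r `^ be * r ^+ M.+1) ->
  exists D : R -> R, forall r : R, 0 < r <= b ->
    is_derive r 1 (fun r => (evol m r p).[y]) (D r) /\
    `|D r| <= B * eta * y ^+ M.+1 * r `^ be / r.
Proof.
move=> B0 /andP[y0 yb] ps hB hQ.
pose I k r := \int[mu]_(t in `]0, r]) (t ^+ k.+1 * ((q t - 1) * m k t)).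
exists (fun r => \sum_(k < size p) p`_k * y ^+ k * (r ^- k.+1 * I k r)).
move=> r rb; have /andP[r0 rb'] := rb; split.
  rewrite (_ : (fun r => (evol m r p).[y]) =
    (fun r => \sum_(k < size p) (p`_k * y ^+ k) * m k r)); last first.
    apply/funext => x; rewrite horner_evol; apply: eq_bigr => k _; ring.
  apply: (@is_derive_sum_ord (size p) (fun k r => p`_k * y ^+ k * m k r)
    (fun k => p`_k * y ^+ k * (r ^- k.+1 * I k r)) r) => k _.
  have [p0|pk] := eqVneq p`_k 0.
    rewrite p0 !mul0r (_ : (fun r => _) = cst 0); first exact: is_derive_cst.
    by apply/funext => x; rewrite !mul0r.
  have [_ d _] := sol (ps _ pk).1.
  exact: (@is_deriveZ _ _ _ (m k) (p`_k * y ^+ k) r 1 _ (d r r0)).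
pose f k t := (p`_k * y ^+ k * r ^- k.+1) * (t ^+ k.+1 * ((q t - 1) * m k t)).
have fi k : mu.-integrable `]0, r] (EFin \o f k).
  have [p0|pk] := eqVneq p`_k 0.
    rewrite /f p0 !mul0r (_ : _ \o _ = cst 0%E); first exact: integrable0.
    by apply/funext => x /=; rewrite mul0r.
  by apply: integrable_scaler => //; have [h _ _] := sol (ps _ pk).1; exact: h.
have [si sE] := Rintegral_sum_ord (@measurable_itv R `]0, r]) (fun k (_ : (k < size p)%N) => fi k).
have -> : \sum_(k < size p) p`_k * y ^+ k * (r ^- k.+1 * I k r) =
    \int[mu]_(t in `]0, r]) \sum_(k < size p) f k t.
  rewrite sE; apply: eq_bigr => k _; rewrite mulrA /I /f.
  have [p0|pk] := eqVneq p`_k 0.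
    rewrite p0 !mul0r (@eq_Rintegral _ _ _ _ _ (fun=> 0)) ?Rintegral_cst ?mul0r// => x _.
    by rewrite mul0r.
  by rewrite RintegralZl//; have [h _ _] := sol (ps _ pk).1; exact: h.
have fE t : 0 < t -> \sum_(k < size p) f k t = t / r * (q t - 1) * (evol m t p).[y * t / r].
  move=> t0; rewrite horner_evol mulr_sumr; apply: eq_bigr => k _; rewrite /f.
  rewrite !exprS !exprMn exprVn.
  have : r ^+ k != 0 by rewrite gt_eqF// exprn_gt0.
  have : r != 0 by rewrite gt_eqF.
  by move: (r ^+ k) (t ^+ k) (y ^+ k) => u v w *; field; apply/andP; split.
apply: (le_trans (le_normr_Rintegral _ si)) => //.
have QM : mu.-integrable `]0, r] (EFin \o (fun t => Q t * t ^+ M)).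
  rewrite (_ : (fun t => _) = (fun t => t ^+ M * Q t)); last by apply/funext => t; rewrite mulrC.
  apply: (@integrableMl_le _ _ _ _ (r ^+ M)) => //.
  - exact: Q_integrable.
  - move=> t; rewrite /= in_itv/= => /andP[t0 tr].
    by rewrite normrX gtr0_norm// lerXn2r// nnegrE ltW.
apply: (@le_trans _ _ (\int[mu]_(t in `]0, r]) (B * y ^+ M.+1 / r ^+ M.+2 * (Q t * t ^+ M)))).
  apply: le_Rintegral => //; [exact: integrable_normr|exact: integrable_scaler|].
  move=> t; rewrite /= in_itv/= => /andP[t0 tr]; rewrite fE//.
  have tr0 : 0 < t / r by rewrite divr_gt0.
  have yt0 : 0 < y * t / r by rewrite divr_gt0// mulr_gt0.
  have ytb : y * t / r <= b.
    rewrite ler_pdivrMr//; apply: ler_pM => //; exact: ltW.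
  rewrite (normrM (t / r * (q t - 1))) (normrM (t / r)) (gtr0_norm tr0).
  apply: (@le_trans _ _ (t / r * `|q t - 1| * (B * (y * t / r) ^+ M.+1))).
    have tb : t <= b by exact: le_trans rb'.
    have hb : `|(evol m t p).[y * t / r]| <= B * (y * t / r) ^+ M.+1.
      by apply: hB; rewrite ?t0 ?yt0.
    apply: ler_wpM2l hb; rewrite mulr_ge0//; exact: ltW.
  rewrite le_eqVlt; apply/orP; left; apply/eqP; rewrite /Q !exprS expr0 !exprMn exprVn.
  have : r ^+ M != 0 by rewrite gt_eqF// exprn_gt0.
  have : r != 0 by rewrite gt_eqF.
  by move: (`|q t - 1|) (r ^+ M) (t ^+ M) (y ^+ M) => a u v w *; field; apply/andP; split.
rewrite RintegralZl//.
have c0 : 0 <= B * y ^+ M.+1 / r ^+ M.+2.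
  by apply: divr_ge0; [apply: mulr_ge0 => //|]; apply: exprn_ge0; exact: ltW.
apply: (le_trans (ler_wpM2l c0 (hQ r rb))).
rewrite le_eqVlt; apply/orP; left; apply/eqP; rewrite (exprS r M.+1).
have : r ^+ M.+1 != 0 by rewrite gt_eqF// exprn_gt0.
have : r != 0 by rewrite gt_eqF.
by move: (r ^+ M.+1) (y ^+ M.+1) (r `^ be) => u v w *; field; apply/andP; split.
Qed.

(* If [B] bounds the evolution on the scale [z^(M+1)] then so does
   [A + e B], whence a bound close to the fixed point [A / (1 - e)]. *)
Lemma evol_close (e : R) : 0 < e -> e <= 1 / 2 ->
  exists M0 : nat, forall M : nat, (M0 <= M)%N ->
  forall p (A : R), supported p (fun k => S k /\ (M < k)%N) -> 0 <= A ->
  (forall y, 0 < y <= b -> `|p.[y]| <= A * y ^+ M.+1) ->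
  forall r y, 0 < r <= b -> 0 < y <= b ->
    `|(evol m r p).[y] - p.[y]| <= 2 * e * A * y ^+ M.+1.
Proof.
move=> e0 e2; have [be be0 hest] := est.
have bbe : 0 < b `^ be by exact: powR_gt0.
(* Chosen so that integrating the derivative bound up to [b] yields exactly [e B z^(M+1)]. *)
have eta0 : 0 < e * be / b `^ be by rewrite divr_gt0// mulr_gt0.
have [M0 hM0] := hest _ eta0.
exists M0 => M MM p A ps A0 pA.
have pS : supported p S by move=> k /ps[].
have improve B : 0 <= B ->
  (forall t z, 0 < t <= b -> 0 < z <= b -> `|(evol m t p).[z]| <= B * z ^+ M.+1) ->
  forall t z, 0 < t <= b -> 0 < z <= b -> `|(evol m t p).[z] - p.[z]| <= e * B * z ^+ M.+1.
  move=> B0 hB t z tb zb; have /andP[z0 _] := zb; have /andP[t0 tb'] := tb.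
  have [D hD] := evol_derive B0 zb ps hB (hM0 M MM).
  have zM : 0 <= z ^+ M.+1 by rewrite exprn_ge0// ltW.
  have c0 : 0 <= B * (e * be / b `^ be) * z ^+ M.+1.
    by rewrite mulr_ge0// mulr_ge0// ltW.
  have := derive_powR_bound be0 c0 (fun r rb => (hD r rb).1) (fun r rb => (hD r rb).2)
    (@evol_cvg p z pS) tb.
  move=> /le_trans; apply.
  have tbe : t `^ be <= b `^ be.
    by rewrite ge0_ler_powR ?nnegrE ?(ltW be0) ?(ltW t0) ?(ltW b0).
  have -> : e * B * z ^+ M.+1 = B * (e * be / b `^ be) * z ^+ M.+1 / be * b `^ be.
    by field; rewrite !gt_eqF.
  by rewrite ler_wpM2l// divr_ge0// ltW.
have [B0 [B00 hB0]] := evol_bounded ps.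
(* As [e <= 1/2], a bound [2 A + x] improves to [A + e (2 A + x) <= 2 A + x / 2]: the part depending
   on the coefficients is halved each time. *)
have iter (n : nat) t z : 0 < t <= b -> 0 < z <= b ->
    `|(evol m t p).[z]| <= (2 * A + B0 / 2 ^+ n) * z ^+ M.+1.
  elim: n t z => [|n IH] t z tb zb.
    have /andP[z0 _] := zb.
    apply: (le_trans (hB0 t z tb zb)); rewrite expr0 divr1 ler_wpM2r ?exprn_ge0 ?(ltW z0)//.
    by rewrite lerDr mulr_ge0.
  have n0 : 0 <= B0 / 2 ^+ n by rewrite divr_ge0// exprn_ge0.
  have h := improve _ (addr_ge0 (mulr_ge0 _ A0) n0) IH t z tb zb.
  have /andP[z0 _] := zb.
  have zM : 0 <= z ^+ M.+1 by rewrite exprn_ge0// ltW.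
  have -> : (evol m t p).[z] = ((evol m t p).[z] - p.[z]) + p.[z] by ring.
  apply: (le_trans (ler_normD _ _)).
  apply: (le_trans (lerD (h _) (pA z zb))) => //.
  rewrite -mulrDl ler_wpM2r//.
  have -> : B0 / 2 ^+ n.+1 = B0 / 2 ^+ n / 2 by rewrite exprS; field; rewrite gt_eqF// exprn_gt0.
  move: (B0 / 2 ^+ n) n0 => x x0.
  have : e * (2 * A + x) <= 1 / 2 * (2 * A + x).
    by rewrite ler_wpM2r// addr_ge0// mulr_ge0.
  lra.
move=> r y rb yb; have /andP[y0 _] := yb.
have yM : 0 < y ^+ M.+1 by rewrite exprn_gt0.
rewrite -ler_pdivrMr//; apply/ler_addgt0Pr => d d0.
pose n := Num.truncn (B0 / d).
have n2 : B0 / 2 ^+ n <= d.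
  rewrite ler_pdivrMr ?exprn_gt0// mulrC -ler_pdivrMr//.
  apply: (le_trans (ltW (truncnS_gt _))).
  by rewrite -natrX ler_nat ltn_expl.
have n0 : 0 <= B0 / 2 ^+ n by rewrite divr_ge0// exprn_ge0.
have h := improve _ (addr_ge0 (mulr_ge0 _ A0) n0) (iter n) r y rb yb.
rewrite ler_pdivrMr//; apply: (le_trans (h _)) => //; rewrite ler_wpM2r ?(ltW yM)//.
have : e * (B0 / 2 ^+ n) <= 1 * d by apply: ler_pM => //; lra.
by move: (B0 / _) => x; lra.
Qed.

End OnePotential.

End Perturbation.

(** * Density and uniqueness *)

Section AeZero.
Variable R : realType.
Notation mu := (@lebesgue_measure R).

(* Piecewise linear, equal to 0 up to [x] and to 1 from [x + e] on. *)
Let ramp (x e t : R) : R := (`|(t - x) / e| - `|(t - x) / e - 1| + 1) / 2.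

Let ramp_continuous x e : continuous (ramp x e).
Proof.
have c1 : continuous (fun t : R => (t - x) / e).
  by move=> t; apply: cvgM; [apply: cvgB; [exact: cvg_id|exact: cvg_cst]|exact: cvg_cst].
move=> t; apply: cvgM; last exact: cvg_cst.
apply: cvgD; last exact: cvg_cst.
apply: cvgB; first by apply: cvg_norm; exact: c1.
by apply: cvg_norm; apply: cvgB; [exact: c1|exact: cvg_cst].
Qed.

Let ramp_le1 x e t : 0 <= ramp x e t <= 1.
Proof.
rewrite /ramp; move: ((t - x) / e) => y.
by have [y0|y0] := leP 0 y; have [y1|y1] := leP 1 y;
  rewrite ?(ger0_norm y0) ?(ltr0_norm y0);
  [rewrite (@ger0_norm _ (y - 1))|rewrite (@ler0_norm _ (y - 1))
  |rewrite (@ger0_norm _ (y - 1))|rewrite (@ler0_norm _ (y - 1))]; lra.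
Qed.

Let ramp0 x e t : 0 < e -> t <= x -> ramp x e t = 0.
Proof.
move=> e0 tx; have : (t - x) / e <= 0 by rewrite pmulr_lle0 ?invr_gt0// subr_le0.
by rewrite /ramp; move: ((t - x) / e) => y y0; rewrite (ler0_norm y0) ler0_norm; lra.
Qed.

Let ramp1 x e t : 0 < e -> x + e <= t -> ramp x e t = 1.
Proof.
move=> e0 tx; have : 1 <= (t - x) / e by rewrite ler_pdivlMr// mul1r; lra.
rewrite /ramp; move: ((t - x) / e) => y y0.
by rewrite (@ger0_norm _ y) ?(@ger0_norm _ (y - 1)); lra.
Qed.

(** The ramp at [x] is a test function, as [x > 0] makes it vanish at 0. It differs from the
    indicator of []x, b]] only on []x, x + e]], where the integral of [|P|] is small. *)
Lemma tail_integral_zero (P : R -> R) (b : R) : 0 < b ->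
  mu.-integrable `]0, b] (EFin \o P) ->
  (forall G : R -> R, continuous G -> G 0 = 0 ->
    \int[mu]_(t in `]0, b]) (G t * P t) = 0) ->
  forall x, 0 < x <= b -> \int[mu]_(t in `]x, b]) P t = 0.
Proof.
move=> b0 iP HP x /andP[x0]; rewrite le_eqVlt => /predU1P[->|xb].
  by rewrite set_itv_ge ?bnd_simp ?ltxx// Rintegral_set0.
apply/eqP; rewrite -normr_le0; apply/ler_addgt0Pr => eps eps0; rewrite add0r.
have ixb : mu.-integrable `[x, b] (EFin \o (fun t => `|P t|)).
  apply: integrable_normr => //; apply: (integrableS _ _ _ iP) => // t.
  by rewrite /= !in_itv/= => /andP[xt ->]; rewrite (lt_le_trans x0).
have /cvgrPdist_le/(_ _ eps0) := parameterized_integral_cvg_left xb ixb.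
move=> /nbhs_ballP[d /= d0 hd].
pose e := Num.min d (b - x) / 2.
have e20 : 0 < Num.min d (b - x) by rewrite lt_min d0 subr_gt0.
have [ed eb] : 2 * e <= d /\ 2 * e <= b - x.
  have -> : 2 * e = Num.min d (b - x) by rewrite /e; field.
  by rewrite !ge_min !lexx ?orbT.
have e0 : 0 < e by rewrite divr_gt0.
have small : \int[mu]_(t in `[x, x + e]) `|P t| <= eps.
  have := hd (x + e); rewrite /ball/= opprD addrA subrr sub0r normrN gtr0_norm//.
  move=> /(_ _); rewrite sub0r normrN /parameterized_integral => h.
  by apply: (le_trans (ler_norm _)); apply: h; lra.
have HG := HP _ (@ramp_continuous x e) (ramp0 e0 (ltW x0)).
have mG (D : set R) : measurable_fun D (ramp x e : measurableTypeR R -> measurableTypeR R).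
  by apply: measurable_funTS; apply: continuous_measurable_fun; exact: ramp_continuous.
have iG (D : set R) : measurable D -> mu.-integrable D (EFin \o P) ->
    mu.-integrable D (EFin \o (fun t => ramp x e t * P t)).
  move=> mD iPD; apply: (@integrableMl_le _ _ _ _ 1) => //.
    exact: mG.
  by move=> t _; have /andP[h1 h2] := ramp_le1 x e t; rewrite ger0_norm.
have sub (u v : R) : 0 <= u -> v <= b -> `]u, v]%classic `<=` `]0, b]%classic.
  move=> u0 vb t; rewrite /= !in_itv/= => /andP[ut tv].
  by rewrite (le_lt_trans u0)// (le_trans tv).
have iPx : mu.-integrable `]x, b] (EFin \o P).
  by apply: (integrableS _ _ _ iP) => //; apply: sub => //; exact: ltW.
have E1 : \int[mu]_(t in `]x, b]) (ramp x e t * P t) = 0.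
  rewrite -(@Rintegral_itvB _ _ (BRight 0) (BRight b) x (iG _ _ iP)) ?bnd_simp ?ltW//.
  rewrite HG (@eq_Rintegral _ _ _ _ _ (fun=> 0)) ?Rintegral_cst ?mul0r ?subr0//.
  by move=> t; rewrite inE/= in_itv/= => /andP[_ tx]; rewrite ramp0// mul0r.
have E2 : \int[mu]_(t in `]x, b]) P t =
    \int[mu]_(t in `]x, b]) (P t - ramp x e t * P t).
  by rewrite RintegralB// ?E1 ?subr0//; exact: iG.
have iD : mu.-integrable `]x, b] (EFin \o (fun t => P t - ramp x e t * P t)).
  by apply: integrable_subr => //; exact: iG.
have xeb : x + e <= b by lra.
rewrite E2; apply: (le_trans (le_normr_Rintegral _ iD)) => //.
have iD' : mu.-integrable `]x, b] (EFin \o (fun t => `|P t - ramp x e t * P t|)).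
  exact: integrable_normr.
have E3 := @Rintegral_itvB _ _ (BRight x) (BRight b) (x + e) iD'.
rewrite !bnd_simp in E3; have {}E3 := E3 _ xeb.
have Ez : \int[mu]_(t in `](x + e), b]) `|P t - ramp x e t * P t| = 0.
  rewrite (@eq_Rintegral _ _ _ _ _ (fun=> 0)) ?Rintegral_cst ?mul0r//.
  by move=> t; rewrite inE/= in_itv/= => /andP[xt _]; rewrite ramp1 ?mul1r ?subrr ?normr0// ltW.
rewrite Ez in E3.
have -> : \int[mu]_(t in `]x, b]) `|P t - ramp x e t * P t| =
   \int[mu]_(t in `]x, (x + e)]) `|P t - ramp x e t * P t|.
  by apply/eqP; rewrite -subr_eq0 E3// lerDl ltW.
apply: le_trans small.
have iN : mu.-integrable `]x, (x + e)] (EFin \o (fun t => `|P t|)).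
  apply: integrable_normr => //; apply: (integrableS _ _ _ iP) => //.
  by apply: sub => //; exact: ltW.
rewrite -Rintegral_itv_obnd_cbnd//.
apply: le_Rintegral => //.
  apply: (integrableS _ _ _ iD') => // t; rewrite /= !in_itv/= => /andP[-> te].
  exact: le_trans xeb.
move=> t _; have /andP[h1 h2] := ramp_le1 x e t.
have -> : P t - ramp x e t * P t = (1 - ramp x e t) * P t by ring.
by rewrite normrM ler_piMl// ger0_norm; lra.
Qed.

(** Vanishing tails make the primitive of [P], extended by 0, vanish up to [b]; Lebesgue's
    differentiation theorem concludes. *)
Lemma ae_zero (P : R -> R) (b : R) : 0 < b ->
  mu.-integrable `]0, b] (EFin \o P) ->
  (forall G : R -> R, continuous G -> G 0 = 0 ->
    \int[mu]_(t in `]0, b]) (G t * P t) = 0) ->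
  {ae mu, forall t, 0 < t < b -> P t = 0}.
Proof.
move=> b0 iP HP; have tail := tail_integral_zero b0 iP HP.
pose f := P \_ `]0, b].
have fi : mu.-integrable setT (EFin \o f).
  by rewrite -restrict_EFin; apply/integrable_restrict => //=; rewrite setTI.
have floc : locally_integrable setT f by exact: open_integrable_locally openT fi.
have fi' (y : R) : mu.-integrable `]-oo, y] (EFin \o f) by apply: integrableS fi.
have FTC := FTC1Ny fi' floc.
(* Tails start at some [x > 0]; the whole integral is recovered by letting that point tend to 0. *)
have tot : \int[mu]_(t in `]0, b]) P t = 0.
  apply/eqP; rewrite -normr_le0; apply/ler_addgt0Pr => e e0; rewrite add0r.
  have [d [d0 db hd]] := Rintegral_oc_cvg0 b0 e0 iP.
  have := @Rintegral_itvB _ _ (BRight 0) (BRight b) d iP.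
  rewrite (tail d) ?d0// !bnd_simp => /(_ (ltW d0) db)/eqP.
  by rewrite subr_eq0 => /eqP ->; apply: hd; rewrite d0 lexx.
have F0 (y : R) : y <= b -> \int[mu]_(t in `]-oo, y]) f t = 0.
  move=> yb; rewrite /f -Rintegral_mkcondr.
  have [y0|y0] := leP y 0.
    rewrite (_ : _ `&` _ = set0) ?Rintegral_set0//; apply/seteqP; split => // t [] /=.
    by rewrite !in_itv/= => ty /andP[t0 _]; have := lt_le_trans t0 (le_trans ty y0); rewrite ltxx.
  rewrite (_ : _ `&` _ = `]0, y]%classic).
    have := @Rintegral_itvB _ _ (BRight 0) (BRight b) y iP.
    rewrite (tail y) ?y0// tot sub0r !bnd_simp => /(_ (ltW y0) yb)/eqP.
    by rewrite oppr_eq0 => /eqP.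
  apply/seteqP; split => t /=; rewrite !in_itv/=.
    by move=> [-> /andP[->]].
  by move=> /andP[-> ty]; rewrite ty (le_trans ty).
case: FTC => N [mN N0 sub]; exists N; split => // t /= ht; apply: sub => /= -[dF F'].
apply: ht => /andP[t0 tb].
have <- : f t = P t by rewrite /f /patch ifT// inE/= in_itv/= t0 ltW.
rewrite -F' derive1E.
rewrite (_ : 'D_1 _ t = 'D_1 (cst 0) t); first by rewrite derive_cst.
apply: near_eq_derive.
near=> y; rewrite F0//; near: y.
have := lt_nbhsl tb; apply: filterS => y; exact: ltW.
Unshelve. all: by end_near. Qed.

End AeZero.

(** * Density from a perturbation of the identity *)

Section Neumann.
Variable R : realType.
Notation mu := (@lebesgue_measure R).
Implicit Types (S : nat -> Prop) (h : R -> R).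

Lemma muntz_dense_itv S h (b e : R) : 0 < b -> muntz_set R S ->
  {within `[0, b], continuous h} -> h 0 = 0 -> 0 < e ->
  exists p, supported p S /\ forall x : R, 0 <= x <= b -> `|h x - p.[x]| <= e.
Proof.
move=> b0 mS ch h0 e0.
have ch' : {within `[0, 1], continuous (fun x => h (b * x))}.
  have in01 (x : R) : `[0, 1]%classic x -> `[0, b]%classic (b * x).
    rewrite /= !in_itv/= => /andP[x0 x1].
    by rewrite mulr_ge0 ?(ltW b0)//= ler_piMr// ltW.
  move: ch => /subspace_continuousP ch; apply/subspace_continuousP => x x01.
  apply: (@cvg_comp _ _ _ _ h) (ch _ (in01 _ x01)) => U /= hU.
  have bx : b * t @[t --> x] --> b * x by apply: cvgM; [exact: cvg_cst|exact: cvg_id].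
  change (\forall t \near x, `[0, 1]%classic t -> U (b * t)).
  have := bx [set y | `[0, b]%classic y -> U y] hU.
  apply: (@filterS _ (nbhs (x : R)) (nbhs_filter (x : R))) => t Ut /in01; exact: Ut.
have [|p [pS hp]] := muntz_dense mS ch' _ e0; first by rewrite mulr0.
exists (\poly_(k < size p) (p`_k * b ^- k)); split=> [k|x /andP[x0 xb]].
  rewrite coef_poly; case: ifP => _; last by rewrite eqxx.
  by move=> pk; apply: pS; apply: contraNneq pk => ->; rewrite mul0r.
have := hp (x / b); rewrite (mulrC b) divfK ?gt_eqF// divr_ge0 ?(ltW b0)//=.
rewrite ler_pdivrMr// mul1r => /(_ xb).
rewrite (_ : p.[x / b] = (\poly_(k < size p) (p`_k * b ^- k)).[x])//.
rewrite horner_poly horner_coef; apply: eq_bigr => k _.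
by rewrite expr_div_n; ring.
Qed.

Lemma integrable_continuousM (b : R) (w h : R -> R) :
  mu.-integrable `]0, b] (EFin \o w) -> {within `[0, b], continuous h} ->
  mu.-integrable `]0, b] (EFin \o (fun t => h t * w t)).
Proof.
move=> iw ch; have [K hK] := continuous_bounded ch.
apply: (@integrableMl_le _ _ _ _ K) => //.
  apply: (@measurable_funS _ _ _ _ `[0, b]) => //.
    by move=> t /=; rewrite !in_itv/= => /andP[/ltW -> ->].
  by apply: subspace_continuous_measurable_fun => //; exact: measurable_itv.
by move=> t /=; rewrite in_itv/= => /andP[t0 tb]; apply: hK; rewrite ltW.
Qed.

(* The functional [w] sees [r - g r] as 0, and [r |-> r - g r] moves [r] by at
   most half its norm: replacing [r] by an approximation of [g r] halves the
   bound on the functional at each step. *)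
Lemma neumann_density S (b : R) (w : R -> R) (g : {poly R} -> R -> R) :
  0 < b -> muntz_set R S -> mu.-integrable `]0, b] (EFin \o w) ->
  (forall r, supported r S ->
    [/\ {within `[0, b], continuous (g r)}, g r 0 = 0 &
      \int[mu]_(t in `]0, b]) (g r t * w t) = \int[mu]_(t in `]0, b]) (r.[t] * w t)]) ->
  (forall r A, supported r S -> 0 <= A ->
    (forall t, 0 < t <= b -> `|r.[t]| <= A) ->
    forall t, 0 < t <= b -> `|g r t| <= A / 2) ->
  forall h, {within `[0, b], continuous h} -> h 0 = 0 ->
    \int[mu]_(t in `]0, b]) (h t * w t) = 0.
Proof.
move=> b0 mS iw gP gle.
pose c := \int[mu]_(t in `]0, b]) `|w t|.
have c0 : 0 <= c by apply: Rintegral_ge0.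
have pc (p : {poly R}) : {within `[0, b], continuous (fun t => p.[t])}.
  by apply: continuous_subspaceT => x; exact: continuous_horner.
have close (h1 h2 : R -> R) (e : R) : {within `[0, b], continuous h1} ->
    {within `[0, b], continuous h2} ->
    (forall t, 0 < t <= b -> `|h1 t - h2 t| <= e) ->
    `|\int[mu]_(t in `]0, b]) (h1 t * w t) - \int[mu]_(t in `]0, b]) (h2 t * w t)|
      <= e * c.
  move=> c1 c2 h12.
  have i1 := integrable_continuousM iw c1; have i2 := integrable_continuousM iw c2.
  rewrite -RintegralB//; apply: (le_trans (le_normr_Rintegral _ (integrable_subr _ i1 i2))) => //.
  rewrite /c -RintegralZl//; last exact: integrable_normr.
  apply: le_Rintegral => //.
  - exact/integrable_normr/integrable_subr.
  - exact/integrable_scaler/integrable_normr.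
  move=> t /=; rewrite in_itv/= => tb.
  by rewrite -mulrBl normrM ler_wpM2r// h12.
have bound (n : nat) r (A : R) : supported r S -> 0 <= A ->
    (forall t, 0 < t <= b -> `|r.[t]| <= A) ->
    `|\int[mu]_(t in `]0, b]) (r.[t] * w t)| <= c * A / 2 ^+ n.
  elim: n r A => [|n IH] r A rS A0 rA.
    have := close (fun t => r.[t]) (fun t => (0 : {poly R}).[t]) A (pc _) (pc _).
    rewrite [X in _ - X](_ : _ = 0); last first.
      rewrite (@eq_Rintegral _ _ _ _ _ (fun=> 0)) ?Rintegral_cst ?mul0r//.
      by move=> t _; rewrite horner0 mul0r.
    rewrite subr0 expr0 divr1 (mulrC c); apply => t tb.
    by rewrite horner0 subr0 rA.
  apply/ler_addgt0Pr => e e0.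
  have [cg g0 <-] := gP _ rS.
  (* Replacing [g r] by [p] costs [e' c] in the integral, and raising the bound on [p] to
     [A / 2 + e'] costs [e' c / 2^n] in the induction hypothesis; both fit into [e]. *)
  have [e' e'0 E] : exists2 e' : R, 0 < e' & e' * (c + c / 2 ^+ n + 1) = e.
    have d0 : 0 < c + c / 2 ^+ n + 1.
      by rewrite ltr_wpDl// addr_ge0// divr_ge0// exprn_ge0.
    by exists (e / (c + c / 2 ^+ n + 1)); [rewrite divr_gt0|rewrite divfK// gt_eqF].
  have [p [pS hp]] := muntz_dense_itv b0 mS cg g0 e'0.
  have h1 : `|\int[mu]_(t in `]0, b]) (g r t * w t) -
      \int[mu]_(t in `]0, b]) (p.[t] * w t)| <= e' * c.
    by apply: close => // t /andP[t0 tb]; apply: hp; rewrite ltW.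
  have h2 : `|\int[mu]_(t in `]0, b]) (p.[t] * w t)| <= c * (A / 2 + e') / 2 ^+ n.
    apply: IH => //; first by rewrite addr_ge0 ?(ltW e'0)// divr_ge0.
    move=> t tb; have := gle _ _ rS A0 rA t tb.
    have : `|g r t - p.[t]| <= e' by apply: hp; case/andP: tb => /ltW -> ->.
    rewrite -(normrN (_ - _)) opprB => h3 h4.
    by rewrite -(subrK (g r t) p.[t]) (le_trans (ler_normD _ _))// addrC lerD.
  rewrite -(subrK (\int[mu]_(t in `]0, b]) (p.[t] * w t))
    (\int[mu]_(t in `]0, b]) (g r t * w t))).
  apply: (le_trans (ler_normD _ _)); apply: (le_trans (lerD h1 h2)).

  have -> : c * (A / 2 + e') / 2 ^+ n = c * A / 2 ^+ n.+1 + e' * (c / 2 ^+ n).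
    by rewrite exprS; field; rewrite expf_neq0// ?pnatr_eq0.
  rewrite -E; move: (c * A / _) (c / 2 ^+ n) => u v.
  by nra.
have zero r : supported r S -> \int[mu]_(t in `]0, b]) (r.[t] * w t) = 0.
  move=> rS; have [A hA] := continuous_bounded (pc r).
  have A0 : 0 <= A by apply: (le_trans _ (hA 0 _)) => //; rewrite lexx ltW.
  apply/eqP; rewrite -normr_le0.
  have hn n : `|\int[mu]_(t in `]0, b]) (r.[t] * w t)| <= c * A / 2 ^+ n.
    by apply: bound => // t /andP[t0 tb]; apply: hA; rewrite ltW.
  have cv : c * A / 2 ^+ n @[n --> \oo] --> (0 : R).
    rewrite -(mulr0 (c * A)); apply: cvgM; first exact: cvg_cst.
    under eq_fun do rewrite -exprVn.
    by apply: cvg_expr; rewrite ger0_norm ?invr_ge0// invf_lt1// ltr1n.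
  rewrite -[leRHS](cvg_lim _ cv)//; apply: limr_ge; first by apply/cvg_ex; exists 0.
  by near=> n; exact: hn.
move=> h ch h0; apply/eqP; rewrite -normr_le0; apply/ler_addgt0Pr => e e0.
rewrite add0r.
have e'0 : 0 < e / (c + 1) by rewrite divr_gt0// ltr_wpDl.
have [p [pS hp]] := muntz_dense_itv b0 mS ch h0 e'0.
have := @close h (fun t => p.[t]) (e / (c + 1)) ch (pc p).
rewrite zero// subr0 => hh; apply: (le_trans (hh _)).
  by move=> t /andP[t0 tb]; apply: hp; rewrite ltW.
by rewrite mulrAC ler_pdivrMr ?ltr_wpDl// ler_wpM2l ?lerDl ?(ltW e0).
Unshelve. all: by end_near. Qed.

End Neumann.

(** * Equality of the potentials from the orthogonality relations *)

Section Uniqueness.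
Variable R : realType.
Notation mu := (@lebesgue_measure R).

Lemma within_continuous_sum_ord (A : set R) n (f : nat -> R -> R) :
  (forall k, (k < n)%N -> {within A, continuous f k}) ->
  {within A, continuous (fun t => \sum_(k < n) f k t)}.
Proof.
elim: n => [_|n IH fc].
  rewrite (_ : (fun t => _) = cst 0); last by apply/funext => t; rewrite big_ord0.
  by apply: continuous_subspaceT => x; exact: cvg_cst.
rewrite (_ : (fun t => _) = (fun t => \sum_(k < n) f k t + f n t)); last first.
  by apply/funext => t; rewrite big_ord_recr.
apply/subspace_continuousP => x Ax; apply: cvgD.
  by move: x Ax; apply/subspace_continuousP; apply: IH => k kn; apply: fc; exact: ltnW.
by move: x Ax; apply/subspace_continuousP; exact: fc.
Qed.

(** Dividing a polynomial with exponents at least [n] by ['X^n] amounts to shifting the index of the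
    solutions, so bounds on the scale [y^n] become plain bounds on the quotient. *)
Lemma evol_mulXn (m : nat -> R -> R) t (r : {poly R}) n :
  evol m t (r * 'X^n) = evol (fun j => m (j + n)%N) t r * 'X^n.
Proof.
apply/polyP => k; rewrite coef_evol !coefMXn; case: ltnP => kn; rewrite ?mul0r//.
by rewrite coef_evol subnK.
Qed.

Lemma supported_mulXn (S : nat -> Prop) n (r : {poly R}) :
  supported r (fun j => S (j + n)%N) ->
  supported (r * 'X^n) (fun k => S k /\ (n <= k)%N).
Proof.
move=> rS k; rewrite coefMXn; case: ltnP => kn; first by rewrite eqxx.
by move/rS; rewrite subnK.
Qed.

Variables (q1 q2 : R -> R) (b : R) (S : nat -> Prop) (m1 m2 : nat -> R -> R).
Hypothesis b0 : 0 < b.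
Hypotheses (est1 : scaled_estimate q1 b) (est2 : scaled_estimate q2 b).
Hypothesis iq1 : mu.-integrable `]0, b] (EFin \o (fun t => t ^+ 2 * q1 t)).
Hypothesis iq2 : mu.-integrable `]0, b] (EFin \o (fun t => t ^+ 2 * q2 t)).
Hypothesis sol1 : forall k, S k -> normalized_solution q1 k (m1 k).
Hypothesis sol2 : forall k, S k -> normalized_solution q2 k (m2 k).
Hypothesis orth_int : forall k, S k -> mu.-integrable `]0, b]
  (EFin \o (fun t => t ^+ k.+1 * ((q2 t - q1 t) * (m1 k t * m2 k t)))).
Hypothesis orth : forall k, S k ->
  \int[mu]_(t in `]0, b]) (t ^+ k.+1 * ((q2 t - q1 t) * (m1 k t * m2 k t))) = 0.
Hypothesis mS : forall n, muntz_set R (fun j => S (j + n)%N).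

(** The factor [t^n] taken out of the polynomials is put into the weight, so that [t^j w n t] is the
    weight of the relation [k = j + n]. *)
Let w n t := t ^+ n.+1 * (q2 t - q1 t).

Let w_integrable n : (0 < n)%N -> mu.-integrable `]0, b] (EFin \o w n).
Proof.
case: n => // n _.
rewrite (_ : w n.+1 = (fun t => t ^+ n * (t ^+ 2 * q2 t - t ^+ 2 * q1 t))); last first.
  by apply/funext => t; rewrite /w -addn2 exprD; ring.
apply: integrable_continuousM; first exact: integrable_subr.
by apply: continuous_subspaceT => x; exact: exprn_continuous.
Qed.

(** The defect between [r] and its image under [x^j |-> x^j m1 m2]. By the orthogonality relations
    the weight annihilates that image, hence does not distinguish [r] from [g n r]. *)
Let g n (r : {poly R}) t :=
  \sum_(j < size r) r`_j * (1 - m1 (j + n)%N t * m2 (j + n)%N t) * t ^+ j.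

Let gE n r t : g n r t = r.[t] -
  (evol (fun j => m2 (j + n)%N) t (evol (fun j => m1 (j + n)%N) t r)).[t].
Proof.
have /(horner_coef_wide t) -> : (size (evol (fun j => m2 (j + n)%N) t
    (evol (fun j => m1 (j + n)%N) t r)) <= size r)%N.
  by apply: leq_trans (size_poly _ _) _; exact: size_poly.
rewrite horner_coef -sumrB.
by apply: eq_bigr => j _; rewrite !coef_evol; ring.
Qed.

Let g_continuous n r : supported r (fun j => S (j + n)%N /\ (0 < j)%N) ->
  {within `[0, b], continuous (g n r)}.
Proof.
move=> rS; pose f j t := r`_j * (1 - m1 (j + n)%N t * m2 (j + n)%N t) * t ^+ j.
apply: (@within_continuous_sum_ord _ _ f) => j _; rewrite /f.
have [->|/rS[Sj j0]] := eqVneq r`_j 0.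
  rewrite (_ : (fun t => _) = cst 0); last by apply/funext => t; rewrite !mul0r.
  by apply: continuous_subspaceT => x; exact: cvg_cst.
have [_ d1 l1] := sol1 Sj; have [_ d2 l2] := sol2 Sj.
have ct t : 0 < t -> {for t, continuous (f j)}.
  move=> t0; apply: differentiable_continuous; apply/derivable1_diffP.
  have [h1 _] := d1 _ t0; have [h2 _] := d2 _ t0.
  apply: derivableM; last by have [] := is_derive_expr j t.
  apply: derivableM; first exact: derivable_cst.
  apply: derivableB; first exact: derivable_cst.
  exact: derivableM.
apply/(continuous_within_itvP _ b0); split.
- by move=> t; rewrite in_itv/= => /andP[t0 _]; exact: ct.
(* The solutions are not prescribed at 0 itself; the factor [0 ^+ j] with [j > 0] fixes the value
   there. *)
- rewrite expr0n gtn_eqF// mulr0.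
  rewrite [X in _ --> X](_ : _ = r`_j * (1 - 1 * 1) * 0 ^+ j); last by ring.
  apply: cvgM.
    apply: cvgM; first exact: cvg_cst.
    apply: cvgB; first exact: cvg_cst.
    by apply: cvgM.
  by apply: cvg_at_right_filter; exact: exprn_continuous.
- by apply: cvg_at_left_filter; exact: ct.
Qed.

Let g0 n r : supported r (fun j => S (j + n)%N /\ (0 < j)%N) -> g n r 0 = 0.
Proof.
move=> rS; apply: big1 => j _.
have [->|/rS[_ j0]] := eqVneq r`_j 0; first by rewrite !mul0r.
by rewrite expr0n gtn_eqF// mulr0.
Qed.

Let g_orth n r : (0 < n)%N -> supported r (fun j => S (j + n)%N /\ (0 < j)%N) ->
  \int[mu]_(t in `]0, b]) (g n r t * w n t) = \int[mu]_(t in `]0, b]) (r.[t] * w n t).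
Proof.
move=> n0 rS.
have ig := integrable_continuousM (w_integrable n0) (g_continuous rS).
have ir : mu.-integrable `]0, b] (EFin \o (fun t => r.[t] * w n t)).
  apply: integrable_continuousM; first exact: w_integrable.
  by apply: continuous_subspaceT => x; exact: continuous_horner.
apply/eqP; rewrite eq_sym -subr_eq0 -RintegralB//.
pose f j t := r`_j * (t ^+ (j + n).+1 *
  ((q2 t - q1 t) * (m1 (j + n)%N t * m2 (j + n)%N t))).
apply/eqP; transitivity (\int[mu]_(t in `]0, b]) \sum_(j < size r) f j t).
  apply: eq_Rintegral => t _; rewrite -mulrBl.
  have -> : r.[t] - g n r t =
      \sum_(j < size r) r`_j * (m1 (j + n)%N t * m2 (j + n)%N t) * t ^+ j.
    by rewrite horner_coef -sumrB; apply: eq_bigr => j _; ring.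
  by rewrite mulr_suml; apply: eq_bigr => j _; rewrite /f /w -addnS exprD; ring.
have if_ j : mu.-integrable `]0, b] (EFin \o f j) /\ \int[mu]_(t in `]0, b]) f j t = 0.
  rewrite /f; have [->|/rS[Sj _]] := eqVneq r`_j 0.
    rewrite (_ : (fun t => _) = cst 0); last by apply/funext => t; rewrite mul0r.
    by split; [exact: integrable0|rewrite Rintegral_cst// mul0r].
  split; first exact/integrable_scaler/orth_int.
  by rewrite RintegralZl ?orth ?mulr0//; exact: orth_int.
have [_ ->] : _ /\ _ := @Rintegral_sum_ord _ _ (size r) f (measurable_itv _)
  (fun j _ => (if_ j).1).
by apply: big1 => j _; exact: (if_ j).2.
Qed.

Let g_bound : exists n, (0 < n)%N /\ forall r A,
  supported r (fun j => S (j + n)%N /\ (0 < j)%N) -> 0 <= A ->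
  (forall t, 0 < t <= b -> `|r.[t]| <= A) ->
  forall t, 0 < t <= b -> `|g n r t| <= A / 2.
Proof.
(* Each evolution has relative error [2/12], so the two together have [1/6 + (1/6) (7/6) = 13/36],
   below [1/2]. *)
have e0 : 0 < 12^-1 :> R by rewrite invr_gt0.
have e1 : 12^-1 <= 1 / 2 :> R by lra.
have [M1 H1] := evol_close b0 est1 iq1 sol1 e0 e1.
have [M2 H2] := evol_close b0 est2 iq2 sol2 e0 e1.
(* With [M = maxn M1 M2] the scale [y^(M+1)] of [evol_close] is exactly the factor [y^n] to be
   cancelled. *)
pose n := (maxn M1 M2).+1; exists n; split=> // r A rS A0 rA t tb.
have /andP[t0 _] := tb.
have nS (p : {poly R}) : supported p (fun j => S (j + n)%N) ->
    supported (p * 'X^n) (fun k => S k /\ (maxn M1 M2 < k)%N).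
  exact: supported_mulXn.
have rS' : supported r (fun j => S (j + n)%N) by move=> j /rS[].
have rS1 : supported (evol (fun j => m1 (j + n)%N) t r) (fun j => S (j + n)%N).
  by move=> j; rewrite coef_evol => rj; apply: rS'; apply: contraNneq rj => ->; rewrite mul0r.
have cancel (u v c y : R) : 0 < y -> `|u * y ^+ n - v * y ^+ n| <= c * y ^+ n -> `|u - v| <= c.
  move=> y0; rewrite -mulrBl normrM normrX (gtr0_norm y0) ler_pM2r//.
  exact: exprn_gt0.
have rA' (p : {poly R}) (c y : R) : 0 < y -> `|p.[y]| <= c -> `|(p * 'X^n).[y]| <= c * y ^+ n.
  move=> y0 pc; rewrite hornerM hornerXn normrM normrX (gtr0_norm y0) ler_wpM2r//.
  by rewrite exprn_ge0// ltW.
(* With [t] frozen, every [y] is needed: the evolved polynomial is the initial datum of the second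
   evolution. Only [h2] is taken on the diagonal [y = t]. *)
have h1 y : 0 < y <= b -> `|(evol (fun j => m1 (j + n)%N) t r).[y] - r.[y]| <= 2 * 12^-1 * A.
  move=> yb; have /andP[y0 _] := yb; apply: (cancel _ _ _ y) => //.
  have := H1 _ (leq_maxl M1 M2) _ _ (nS _ rS') A0 _ t y tb yb.
  rewrite evol_mulXn !hornerM !hornerXn; apply => z zb.
  by rewrite rA' ?rA//; case/andP: zb.
have A'0 : 0 <= A * (1 + 2 * 12^-1) by rewrite mulr_ge0//; lra.
have h2 : `|(evol (fun j => m2 (j + n)%N) t (evol (fun j => m1 (j + n)%N) t r)).[t] -
    (evol (fun j => m1 (j + n)%N) t r).[t]| <= 2 * 12^-1 * (A * (1 + 2 * 12^-1)).
  apply: (cancel _ _ _ t) => //.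
  have := H2 _ (leq_maxr M1 M2) _ _ (nS _ rS1) A'0 _ t t tb tb.
  rewrite evol_mulXn !hornerM !hornerXn; apply => z zb.
  have /andP[z0 _] := zb; apply: rA' => //.
  have := lerD (h1 z zb) (rA z zb).
  by move=> /(le_trans (ler_normD _ _)); rewrite subrK => /le_trans; apply; lra.
rewrite gE distrC; apply: (le_trans (ler_distD (evol (fun j => m1 (j + n)%N) t r).[t] _ _)).
by apply: (le_trans (lerD h2 (h1 t tb))); lra.
Qed.

Lemma ae_eq_potential : {ae mu, forall t, 0 < t < b -> q1 t = q2 t}.
Proof.
have [n [n0 gb]] := g_bound.
have mSn : muntz_set R (fun j => S (j + n)%N /\ (0 < j)%N).
  move=> N K; have [s [us hs sK]] := mS n N K; exists s; split=> // k /hs[Sk Nk].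
  by split => //; split => //; exact: leq_ltn_trans Nk.
have iw := w_integrable n0.
have dense := neumann_density b0 mSn iw
  (fun r rS => And3 (g_continuous rS) (g0 rS) (g_orth n0 rS)) gb.
have [N [mN N0 sub]] : {ae mu, forall t, 0 < t < b -> w n t = 0}.
  apply: ae_zero => // h ch h0; apply: dense => //.
  exact: continuous_subspaceT.
exists N; split => // t ht; apply: sub => /= wt; apply: ht => tb; have := wt tb.
have /andP[t0 _] := tb.
move/eqP; rewrite /w mulf_eq0 expf_eq0 (gt_eqF t0)/= subr_eq0 => /eqP ->.
by [].
Qed.

End Uniqueness.

(** For [l >= 1] the exponent [j = 2 l + 1 - n] is at most [3 l], so its reciprocal is at least a
    third of [1/l]: hence the target [3 K]. Terms with [l < c] contribute at most [c] and are
    discarded; for [l >= c] the subtraction is not truncated and [j > N]. *)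
Lemma muntz_set_odd (R : realType) (L : set nat) :
  (\esum_(l in L `\ 0%N) ((l%:R : R)^-1)%:E = +oo)%E ->
  forall n, muntz_set R (fun j => exists l, L l /\ (j + n)%N = l.*2.+1).
Proof.
move=> Loo n N K; pose c := (N + n).+1.
have : ((3 * K + c%:R)%:E < \esum_(l in L `\ 0%N) ((l%:R : R)^-1)%:E)%E by rewrite Loo ltry.
rewrite /esum => /ereal_sup_gt[_ [X [fX XL] <-]].
rewrite fsbig_finite//= sumEFin lte_fin => lt.
pose F : seq nat := finmap.enum_fset (fset_set X).
have uF : uniq F by exact: finmap.fset_uniq.
have FL l : l \in F -> L l.
  by move=> lF; have := in_fset_set fX l; rewrite [LHS]lF => /esym/set_mem/XL[].
have {}lt : 3 * K + c%:R < \sum_(l <- F) (l%:R : R)^-1 := lt.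
pose s := [seq l <- F | (c <= l)%N].
have inL l : l \in s -> L l /\ (c <= l)%N.
  by rewrite mem_filter => /andP[cl /FL].
have small : \sum_(l <- F | (l < c)%N) (l%:R : R)^-1 <= c%:R.
  apply: (@le_trans _ _ (\sum_(l <- F | (l < c)%N) 1%:R)).
    apply: ler_sum => l _; case: l => [|l]; first by rewrite invr0.
    by rewrite invf_le1 ?ltr0n// ler1n.
  rewrite -(natr_sum _ _ _ (fun=> 1%N)) sum1_count ler_nat -size_filter -{2}(size_iota 0 c).
  apply: uniq_leq_size; first exact: filter_uniq.
  by move=> l; rewrite mem_filter mem_iota => /andP[].
have big : 3 * K < \sum_(l <- s) (l%:R : R)^-1.
  rewrite -(ltrD2r c%:R); apply: (lt_le_trans lt).
  rewrite (bigID (fun l => (l < c)%N))/= addrC lerD// big_filter.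
  by under eq_bigl do rewrite -leqNgt.
exists [seq (l.*2.+1 - n)%N | l <- s]; split.
- rewrite map_inj_in_uniq ?filter_uniq// => x y /inL[_ cx] /inL[_ cy]; rewrite /c in cx cy; lia.
- move=> _ /mapP[l /inL[Ll cl] ->]; split; last by rewrite /c in cl; lia.
  by exists l; split => //; rewrite /c in cl; lia.
- rewrite big_map -(ler_pM2l (ltr0Sn R 2 : 0 < 3)) (le_trans (ltW big))// mulr_sumr.
  rewrite big_seq [leRHS]big_seq; apply: ler_sum => l /inL[_ cl].
  have l0 : 0 < l%:R :> R by rewrite ltr0n; lia.
  have j0 : 0 < (l.*2.+1 - n)%:R :> R by rewrite ltr0n; rewrite /c in cl; lia.
  rewrite ler_pdivlMr// mulrC ler_pdivrMr// -natrM ler_nat; lia.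
Qed.

Theorem theorem8p1 (R : realType) (a : R) (L : set nat) (q1 q2 : R -> R)
    (delta1 delta2 : nat -> R) :
  0 < a ->
  (\esum_(l in L `\ 0%N) ((l%:R : R)^-1)%:E = +oo)%E ->
  potential_class a (spherical q1) ->
  potential_class a (spherical q2) ->
  (forall l, L l -> is_phase_shift q1 l (delta1 l)) ->
  (forall l, L l -> is_phase_shift q2 l (delta2 l)) ->
  (forall l, L l -> eq_mod_pi (delta1 l) (delta2 l)) ->
  {ae @lebesgue_measure3 R, forall x, spherical q1 x = spherical q2 x}.
Proof.
move=> a0 Loo Q1 Q2 ph1 ph2 ph.
have [v1 [p1 [p132 mq1 iw1]]] := potential_radial a0 Q1.
have [v2 [p2 [p232 mq2 iw2]]] := potential_radial a0 Q2.
have iq1 b : 0 < b -> _ := fun b0 => radial_integrable p132 mq1 iw1 b0.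
have iq2 b : 0 < b -> _ := fun b0 => radial_integrable p232 mq2 iw2 b0.
(* Any [b > a] serves: the orthogonality relations hold for it, and [0 < t < b] includes [t = a]. *)
pose b := a + 1; have b0 : 0 < b by rewrite addr_gt0.
have ab : a < b by rewrite ltrDl.
pose S k := exists l, L l /\ k = l.*2.+1.
have sols k : exists m : (R -> R) * (R -> R), S k ->
    [/\ normalized_solution q1 k m.1, normalized_solution q2 k m.2,
      (@lebesgue_measure R).-integrable `]0, b]
        (EFin \o (fun t => t ^+ k.+1 * ((q2 t - q1 t) * (m.1 t * m.2 t)))) &
      \int[@lebesgue_measure R]_(t in `]0, b])
        (t ^+ k.+1 * ((q2 t - q1 t) * (m.1 t * m.2 t))) = 0].
  have [[l [Ll ->]]|nS] := pselect (S k); last by exists (id, id).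
  have [m1 [m2 [n1 n2 mi m0]]] := phase_shift_orthogonal a0 iq1 iq2 v1 v2
    (ph1 l Ll) (ph2 l Ll) (ph l Ll).
  by exists (m1, m2) => _; split => //; [exact: mi|exact: m0].
have [m hm] := choice sols.
have [N [mN N0 sub]] : {ae @lebesgue_measure R, forall t, 0 < t < b -> q1 t = q2 t}.
  apply: (@ae_eq_potential _ _ _ _ S (fun k => (m k).1) (fun k => (m k).2)) => //.
  - exact: radial_scaled_estimate p132 mq1 iw1 _ b0.
  - exact: radial_scaled_estimate p232 mq2 iw2 _ b0.
  - exact: iq1.
  - exact: iq2.
  - by move=> k /hm[].
  - by move=> k /hm[].
  - by move=> k /hm[].
  - by move=> k /hm[].
  - exact: muntz_set_odd.
(* The radial result concerns [t > 0] only, so the radius 0 joins the exceptional set. *)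
have mN0 : measurable (N `|` [set 0] : set (measurableTypeR R)).
  by apply: measurableU => //; exact: measurable_set1.
have N00 : @lebesgue_measure R (N `|` [set 0]) = 0%E.
  apply/eqP; rewrite eq_le measure_ge0 andbT.
  have := measureU2 (@lebesgue_measure R) mN (measurable_set1 (0 : R)).
  rewrite [X in (X + _)%E](_ : _ = 0%E)// add0e.
  by rewrite [X in (_ <= X)%E](_ : _ = 0%E)//; exact: lebesgue_measure_set1.
have [Z [mZ Z0 subZ]] := ae_radial mN0 N00.
exists Z; split => // x /= hx; apply: subZ => /= NE; apply: hx; rewrite /spherical.
have [ra|ra] := ltP a (enorm3 x); first by rewrite v1 ?v2.
apply: contrapT => ne; apply: NE; have [r0|] := ltP 0 (enorm3 x).
  left; apply: sub => /= h; apply: ne; apply: h.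
  by rewrite r0 (le_lt_trans ra).
by rewrite le_eqVlt ltNge sqrtr_ge0 orbF => /eqP r0; right.
Qed.
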